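(* Consider the network of $q\ge2$ coupled identical LC oscillators on $n$ nodes $$AA^{T}(\ddot e+\omega_0^2 e)+G\dot e+Be=0,\qquad v=A^{T}e,$$ with $\omega_0>0$, where $\mathrm{rank}(A)=q$, the coupling is bilayer, and accordingly $$G=\begin{bmatrix}G_1&0\\ 0&G_2\end{bmatrix},\quad B=\begin{bmatrix}B_1&0\\ 0&B_2\end{bmatrix},\quad A=\begin{bmatrix}F_1\\ -F_2\end{bmatrix},$$ with $G_1,B_1\in\mathbb{R}^{n_1\times n_1}$ and $G_2,B_2\in\mathbb{R}^{n_2\times n_2}$ Laplacian matrices and $F_1\in\mathbb{R}^{n_1\times q}$, $F_2\in\mathbb{R}^{n_2\times q}$ class-$\mathcal{F}$ matrices, $n_1+n_2=n$. Let $Y\in\mathbb{C}^{q\times q}$ be the effective Laplacian of the network. Then the network is synchronous if and only if $Y$ has a single eigenvalue on the imaginary axis (eigenvalues counted with multiplicity).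
   Context: Network. There are $n$ nodes $\nu_1,\dots,\nu_n$; $e(t)\in\mathbb{R}^n$ is the vector of node voltages and $v(t)=[v_1\ \cdots\ v_q]^T\in\mathbb{R}^q$ the vector of oscillator voltages. $A\in\mathbb{R}^{n\times q}$ is the oriented incidence matrix of the oscillators: if oscillator $k$ extends from node $\nu_r$ (positive terminal) to node $\nu_s$ (negative terminal), $r\neq s$, the $k$th column of $A$ is $I(:,r)-I(:,s)$, where $I(:,r)$ is the $r$th column of the identity. No two oscillators are parallel (no two columns of $A$ are equal up to sign) and every node is incident to at least one oscillator ($A$ has no zero row). $G,B\in\mathbb{R}^{n\times n}$ are the Laplacians of the resistive and inductive couplers. Laplacian matrix: a real symmetric matrix with off-diagonal entries $-w_{rs}$, $w_{rs}=w_{sr}\ge0$, and diagonal entries $\sum_{s\neq r}w_{rs}$. Class $\mathcal{F}$: a matrix is class $\mathcal{F}$ if each entry is $0$ or $1$, each column contains a single nonzero entry, and there are no zero rows. The block form reflects the bilayer structure: the nodes split into the first $n_1$ and last $n_2$ nodes, each oscillator extends between the two groups (positive terminal in the first group), and no coupler extends between the two groups. Effective Laplacian. With $j=\sqrt{-1}$ and $(\cdot)^{+}$ the Moore–Penrose pseudoinverse, $$Y=\begin{bmatrix}0& I\end{bmatrix}\begin{bmatrix}G+jB&-A\\ A^{T}&0\end{bmatrix}^{+}\begin{bmatrix}0\\ I\end{bmatrix}\in\mathbb{C}^{q\times q},$$ where $I$ is the $q\times q$ identity and the zero blocks have conforming sizes. Synchrony. The network is (nontrivially) synchronous if $|v_k(t)|-|v_\ell(t)|\to0$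 as $t\to\infty$ for all pairs $(k,\ell)$ and all initial conditions (i.e. along every solution), and $v_k(t)\not\to0$ for some $k$ and some initial conditions (i.e. along some solution). *)

(* Defs.v *)
From HB Require Import structures.
From mathcomp Require Import all_boot all_order all_algebra.
From mathcomp Require Import all_classical all_reals all_analysis.
From mathcomp Require Import complex.

Set Implicit Arguments.
Unset Strict Implicit.
Unset Printing Implicit Defensive.

Import Order.TTheory GRing.Theory Num.Theory.
Import numFieldNormedType.Exports.

Local Open Scope classical_set_scope.
Local Open Scope ring_scope.
Local Open Scope sesquilinear_scope.
Local Open Scope complex_scope.

Section MoorePenrose.
Variable C : numClosedFieldType.

Definition moore_penrose m n (M : 'M[C]_(m, n)) (X : 'M[C]_(n, m)) : Prop :=
  [/\ M *m X *m M = M, X *m M *m X = X,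
      (M *m X)^t* = M *m X & (X *m M)^t* = X *m M].

(* The default value 0 is never reached, see [mpinvP]. *)
Definition mpinv m n (M : 'M[C]_(m, n)) : 'M[C]_(n, m) :=
  xget 0 [set X | moore_penrose M X].

Lemma ctrmx_mul m n p (M : 'M[C]_(m, n)) (N : 'M[C]_(n, p)) :
  (M *m N)^t* = N^t* *m M^t*.
Proof. by rewrite trmx_mul map_mxM. Qed.

Lemma ctrmxK m n (M : 'M[C]_(m, n)) : (M^t*)^t* = M.
Proof. by apply/matrixP => i j; rewrite !mxE conjCK. Qed.

Lemma ctrmx_gram_eq0 m n (M : 'M[C]_(m, n)) : M *m M^t* = 0 -> M = 0.
Proof.
move=> M0; apply/matrixP => i j; rewrite mxE.
have /matrixP/(_ i i) := M0; rewrite !mxE.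
under eq_bigr do rewrite !mxE -normCK.
move/eqP; rewrite psumr_eq0 => [|k _]; last by rewrite exprn_ge0.
by move/allP/(_ j (mem_index_enum _)); rewrite sqrf_eq0 normr_eq0 => /eqP.
Qed.

Lemma row_free_gram m n (M : 'M[C]_(m, n)) :
  row_free M -> M *m M^t* \in unitmx.
Proof.
move=> fM; rewrite -row_free_unit -kermx_eq0; apply/eqP.
set K := kermx _; have K0 : K *m (M *m M^t*) = 0 by rewrite mulmx_ker.
have : K *m M = 0.
  by apply: ctrmx_gram_eq0; rewrite ctrmx_mul !mulmxA -(mulmxA K) K0 mul0mx.
by move/eqP; rewrite mulmx_free_eq0 // => /eqP.
Qed.

Lemma moore_penrose_full_rank m n r (U : 'M[C]_(m, r)) (V : 'M[C]_(r, n)) :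
  row_full U -> row_free V -> exists X, moore_penrose (U *m V) X.
Proof.
move=> fU fV.
have uV : V *m V^t* \in unitmx by exact: row_free_gram.
have uU : U^t* *m U \in unitmx.
  have := @row_free_gram _ _ (U^t*); rewrite ctrmxK; apply.
  by move: fU; rewrite /row_full /row_free mxrank_map mxrank_tr.
pose P := invmx (V *m V^t*); pose Q := invmx (U^t* *m U).
have hP : P^t* = P.
  by rewrite /P trmx_inv map_invmx ctrmx_mul ctrmxK.
have hQ : Q^t* = Q.
  by rewrite /Q trmx_inv map_invmx ctrmx_mul ctrmxK.
have VP : V *m V^t* *m P = 1%:M by rewrite mulmxV.
have QU : Q *m (U^t* *m U) = 1%:M by rewrite mulVmx.
pose X := V^t* *m P *m Q *m U^t*.
have MX : U *m V *m X = U *m Q *m U^t*.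
  by rewrite /X !mulmxA -(mulmxA U) -(mulmxA U) VP mulmx1.
have XM : X *m (U *m V) = V^t* *m P *m V.
  rewrite /X !mulmxA -(mulmxA _ (U^t*)) -(mulmxA _ Q) QU.
  by rewrite mulmx1.
exists X; split.
- by rewrite MX mulmxA -(mulmxA _ (U^t*)) -(mulmxA U) QU mulmx1.
- rewrite XM /X !mulmxA -(mulmxA _ V) -(mulmxA _ (V *m _)) VP.
  by rewrite mulmx1.
- by rewrite MX !ctrmx_mul ctrmxK hQ mulmxA.
- by rewrite XM !ctrmx_mul ctrmxK hP mulmxA.
Qed.

Lemma moore_penrose_exists m n (M : 'M[C]_(m, n)) :
  exists X, moore_penrose M X.
Proof.
have := moore_penrose_full_rank (col_base_full M) (row_base_free M).
by rewrite mulmx_base.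
Qed.

Lemma mpinvP m n (M : 'M[C]_(m, n)) : moore_penrose M (mpinv M).
Proof.
by have [X MX] := moore_penrose_exists M; apply: (@xgetPex _ 0 _); exists X.
Qed.

Lemma moore_penrose_uniq m n (M : 'M[C]_(m, n)) X Z :
  moore_penrose M X -> moore_penrose M Z -> X = Z.
Proof.
move=> [x1 x2 x3 x4] [z1 z2 z3 z4].
have MXZ : M *m X = M *m Z.
  by rewrite -x3 -{1}z1 -mulmxA ctrmx_mul x3 z3 mulmxA x1.
have XZM : X *m M = Z *m M.
  by rewrite -x4 -{1}z1 !mulmxA -(mulmxA (X *m M)) ctrmx_mul x4 z4
     -mulmxA (mulmxA M) x1.
by rewrite -x2 -mulmxA MXZ mulmxA XZM z2.
Qed.

(* Listed with algebraic multiplicity, in an unspecified order. *)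
Definition eigenvalues n (M : 'M[C]_n) : seq C :=
  sval (closed_field_poly_normal (char_poly M)).

Lemma eigenvaluesE n (M : 'M[C]_n) :
  char_poly M = \prod_(z <- eigenvalues M) ('X - z%:P).
Proof.
rewrite /eigenvalues; case: closed_field_poly_normal => r /= {1}->.
by rewrite (monicP (char_poly_monic M)) scale1r.
Qed.

End MoorePenrose.

Section Network.
Variable R : realType.

Definition laplacian n (L : 'M[R]_n) : Prop :=
  exists W : 'M[R]_n, [/\ W^T = W, forall r s, 0 <= W r s &
    L = \matrix_(r, s) if r == s then \sum_(k | k != r) W r k else - W r s].

Definition class_F m n (F : 'M[R]_(m, n)) : Prop :=
  [/\ forall i j, F i j = 0 \/ F i j = 1,
      forall j, #|[pred i | F i j != 0]| = 1%N &
      forall i, row i F != 0].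

Section Definitions.
Variables n q : nat.
Variables (A : 'M[R]_(n, q)) (G B : 'M[R]_n) (w0 : R).

Definition oriented_incidence : Prop := forall k, exists r s : 'I_n,
  r != s /\ col k A = col r 1%:M - col s 1%:M.

Definition no_parallel_oscillators : Prop := forall k l,
  k != l -> col k A != col l A /\ col k A != - col l A.

Definition no_isolated_node : Prop := forall r, row r A != 0.

(* Solutions live on [0, +oo[: the values at negative times are unconstrained
   and merely serve as an extension making the derivatives at 0 two-sided. *)
Definition network_solution (e : R -> 'cV[R]_n) : Prop :=
  forall t : R, 0 <= t ->
    [/\ derivable e t 1, derivable e^`()%classic t 1 &
        A *m A^T *m (e^`(2)%classic t + w0 ^+ 2 *: e t)
          + G *m e^`()%classic t + B *m e t = 0].

Definition voltage (e : R -> 'cV[R]_n) (k : 'I_q) (t : R) : R :=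
  (A^T *m e t) k 0.

Definition synchronous : Prop :=
  (forall e, network_solution e -> forall k l : 'I_q,
     `|voltage e k t| - `|voltage e l t| @[t --> +oo] --> (0 : R)) /\
  (exists e, network_solution e /\ exists k : 'I_q,
     ~ (voltage e k t @[t --> +oo] --> (0 : R))).

Definition toC m p (M : 'M[R]_(m, p)) : 'M[R[i]]_(m, p) :=
  map_mx (real_complex R) M.

Definition effective_laplacian : 'M[R[i]]_q :=
  row_mx (0 : 'M[R[i]]_(q, n)) 1%:M
    *m mpinv (block_mx (toC G + 'i%C *: toC B) (- toC A) (toC A)^T 0)
    *m col_mx (0 : 'M[R[i]]_(n, q)) 1%:M.

End Definitions.

Definition nb_imaginary_eigenvalues n (M : 'M[R[i]]_n) : nat :=
  count (fun z => complex.Re z == 0) (eigenvalues M).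

End Network.

(* Main.v *)
(* Both properties say that no undamped nonsynchronous mode exists, that is, no
   [x] with [G x = 0], [B x = mu A A^T x], [1^T A^T x = 0] and [A^T x <> 0].

   For the spectrum: [Y u = w] iff [A^T x = u] and [(G + jB) x = A w] for some
   [x].  If [w] is an imaginary multiple of [u], the real part of
   [x^* (G + jB) x] vanishes, so [G x = 0] and [x] is a mode.  Since [Y] is
   annihilated by [1] on the left, [Y + 1 1^T] has the eigenvalues of [Y] with
   one 0 moved to [q]; so 0 is the only imaginary eigenvalue iff [Y] has no
   imaginary eigenvector [u] with [1^T u = 0].

   For the dynamics: a mode superposed on the in-phase oscillation gives a
   nonsynchronous solution.  Conversely, once the in-phase oscillation is
   subtracted, the energy identity shows that an eigenvalue with nonnegative
   real part of the remaining linear differential-algebraic system would yield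
   a mode, so without modes that part of the voltages decays. *)

Require Import Defs.
From mathcomp Require Import all_boot all_order all_algebra.
From mathcomp Require Import all_classical all_reals all_analysis.
From mathcomp Require Import complex.
From mathcomp Require Import ring lra.
Import Order.TTheory GRing.Theory Num.Theory.
Import numFieldNormedType.Exports.
Local Open Scope classical_set_scope.
Local Open Scope ring_scope.
Local Open Scope sesquilinear_scope.

Set Implicit Arguments.
Unset Strict Implicit.
Unset Printing Implicit Defensive.

(** * Decay of scalar equations *)

Lemma nonincreasing_of_derive (R : realType) (g dg : R -> R) (T : R) :
    (forall t, T <= t -> is_derive t 1 g (dg t)) ->
    (forall t, T <= t -> dg t <= 0) ->
  forall t, T <= t -> g t <= g T.
Proof.
move=> gd dg0 t Tt.
apply: (@ler0_derive1_nincry _ g T) => // [x|x|].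
- by rewrite in_itv/= andbT => /ltW/gd[].
- rewrite in_itv/= andbT => /ltW Tx.
  by have Dx := gd _ Tx; rewrite derive1E derive_val dg0.
- apply: derivable_within_continuous => x.
  by rewrite in_itv/= andbT => /gd[].
Qed.

(** Once [eps t <= c * (d / 2)], the function [(rho t - d / 2) * expR (c * t)] is nonincreasing, so
    [rho t] exceeds [d / 2] by at most a decaying exponential. *)
Lemma gronwall_tends0 (R : realType) (rho drho eps : R -> R) (c : R) :
    0 < c -> (forall t : R, 0 < t -> is_derive t 1 rho (drho t)) ->
    (forall t : R, 0 < t -> drho t <= - c * rho t + eps t) ->
    (forall t, 0 <= rho t) -> eps t @[t --> +oo] --> (0 : R) ->
  rho t @[t --> +oo] --> (0 : R).
Proof.
move=> c0 rhod rho_le rho0 eps0; apply/cvgrPdist_le => d d0.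
have d2 : 0 < d / 2 by rewrite divr_gt0.
have cd : 0 < c * (d / 2) by rewrite mulr_gt0.
have [T [Treal HT]] : \forall t \near (pinfty_nbhs R), eps t <= c * (d / 2).
  move/cvgrPdist_le : eps0 => /(_ _ cd); apply: filterS => t.
  by rewrite sub0r normrN => /(le_trans (ler_norm _)).
pose T1 := Num.max (T + 1) 1.
have T1T : T < T1 by rewrite /T1 lt_max ltrDl ltr01.
have T10 : 0 < T1 by rewrite /T1 lt_max ltr01 orbT.
pose g t := (rho t - d / 2) * expR (c * t).
pose dg t := (drho t + c * (rho t - d / 2)) * expR (c * t).
have gd t : T1 <= t -> is_derive t 1 g (dg t).
  move=> /(lt_le_trans T10)/rhod Dt.
  have De : is_derive t 1 (fun t => expR (c * t)) (expR (c * t) * c).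
    by apply: is_derive1_comp; apply: is_derive_eq; rewrite scaler1.
  by apply: is_derive_eq; rewrite /dg/= /GRing.scale/=; ring.
have gle t : T1 <= t -> g t <= g T1.
  apply: (nonincreasing_of_derive gd) => {}t Tt; rewrite /dg.
  apply: mulr_le0_ge0; last exact: expR_ge0.
  have := rho_le t (lt_le_trans T10 Tt).
  by have := HT t (lt_le_trans T1T Tt); nra.
have e0 : g T1 * expR (- (c * t)) @[t --> +oo] --> (0 : R).
  rewrite -(mulr0 (g T1)); apply: cvgMr.
  apply: (@cvg_comp _ _ _ (fun t => c * t) (fun t : R => expR (- t)));
    last exact: cvgr_expR.
  exact: gt0_cvgMry.
near=> t.
have Tt : T1 <= t by near: t; by apply: nbhs_pinfty_ge; exact: num_real.
rewrite sub0r normrN ger0_norm//.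
have : g T1 * expR (- (c * t)) <= d / 2.
  near: t; move/cvgrPdist_le : e0 => /(_ _ d2); apply: filterS => t.
  by rewrite sub0r normrN => /(le_trans (ler_norm _)).
have : (rho t - d / 2) <= g T1 * expR (- (c * t)).
  by rewrite expRN ler_pdivlMr ?expR_gt0// gle.
lra.
Unshelve. all: by end_near. Qed.

Lemma tends0_sqr (R : realType) (f : R -> R) :
  f t ^+ 2 @[t --> +oo] --> (0 : R) -> f t @[t --> +oo] --> (0 : R).
Proof.
move=> f0; apply/cvgrPdist_le => d d0.
have d2 : 0 < d ^+ 2 by rewrite exprn_gt0.
move/cvgrPdist_le : f0 => /(_ _ d2); apply: filterS => t.
by rewrite !sub0r !normrN normrX ler_pXn2r// nnegrE// ltW.
Qed.

Lemma tends0_le (R : realType) (f g : R -> R) :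
    (forall t, 0 <= f t <= g t) -> g t @[t --> +oo] --> (0 : R) ->
  f t @[t --> +oo] --> (0 : R).
Proof.
move=> fg; apply: (squeeze_cvgr (f := fun=> 0)); last exact: cvg_cst.
exact: nearW.
Qed.

Lemma tends0_lincomb (R : realType) (a b : R) (f g : R -> R) :
    f t @[t --> +oo] --> (0 : R) -> g t @[t --> +oo] --> (0 : R) ->
  a * f t + b * g t @[t --> +oo] --> (0 : R).
Proof.
move=> f0 g0.
have := cvgD (cvgM (cvg_cst a) f0) (cvgM (cvg_cst b) g0).
by rewrite !mulr0 addr0; apply.
Qed.

Lemma tends0M (R : realType) (f g : R -> R) :
    f t @[t --> +oo] --> (0 : R) -> g t @[t --> +oo] --> (0 : R) ->
  f t * g t @[t --> +oo] --> (0 : R).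
Proof. by move=> f0 g0; have := cvgM f0 g0; rewrite mulr0; apply. Qed.

Lemma tends0_eq0 (R : realType) (f : R -> R) :
  (forall t, 0 < t -> f t = 0) -> f t @[t --> +oo] --> (0 : R).
Proof.
move=> f0; apply: cvg_near_cst.
by exists 0; split => // t; exact: f0.
Qed.

Definition ctends0 (R : realType) (h : R -> R[i]) : Prop :=
  complex.Re (h t) @[t --> +oo] --> (0 : R) /\
  complex.Im (h t) @[t --> +oo] --> (0 : R).

Section ComplexTends.
Variable R : realType.
Implicit Types (h f : R -> R[i]) (z : R[i]).

Lemma complex_ReM z1 z2 : complex.Re (z1 * z2 : R[i]) =
  complex.Re z1 * complex.Re z2 - complex.Im z1 * complex.Im z2.
Proof. by case: z1 z2 => [a b] [c d]. Qed.

Lemma complex_ImM z1 z2 : complex.Im (z1 * z2 : R[i]) =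
  complex.Re z1 * complex.Im z2 + complex.Im z1 * complex.Re z2.
Proof. by case: z1 z2 => [a b] [c d]. Qed.

Lemma ctends0Z z h : ctends0 h -> ctends0 (fun t => z * h t).
Proof.
move=> [hr hi]; split.
  under eq_fun do rewrite complex_ReM -mulNr.
  exact: tends0_lincomb.
by under eq_fun do rewrite complex_ImM; exact: tends0_lincomb.
Qed.

Lemma ctends0B h f : ctends0 h -> ctends0 f -> ctends0 (fun t => h t - f t).
Proof.
move=> [hr hi] [fr fi]; split; under eq_fun do
  rewrite raddfB -[X in X - _]mul1r -mulN1r/=; exact: tends0_lincomb.
Qed.

(** The derivative of [|h|^2] is [2 Re z |h|^2 + 2 Re (h^* f)]. Young's inequality spends half of
    the damping on the second term, and [gronwall_tends0] applies to what remains. *)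
Lemma scalar_ode_tends0 h dh f z : complex.Re z < 0 ->
    (forall t : R, 0 < t ->
      is_derive t 1 (fun s => complex.Re (h s)) (complex.Re (dh t))) ->
    (forall t : R, 0 < t ->
      is_derive t 1 (fun s => complex.Im (h s)) (complex.Im (dh t))) ->
    (forall t, 0 < t -> dh t = z * h t + f t) ->
  ctends0 f -> ctends0 h.
Proof.
move=> z0 hr hi hE [fr fi].
pose a t := complex.Re (h t); pose b t := complex.Im (h t).
pose rho t := a t ^+ 2 + b t ^+ 2.
pose eps t := (- complex.Re z)^-1 *
  (complex.Re (f t) ^+ 2 + complex.Im (f t) ^+ 2).
have z1 : - complex.Re z != 0 by rewrite oppr_eq0 lt_eqF.
have eps0 : eps t @[t --> +oo] --> (0 : R).
  under eq_fun do rewrite /eps mulrDr !expr2.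
  by apply: tends0_lincomb; exact: tends0M.
have rho0 : rho t @[t --> +oo] --> (0 : R).
  apply: (@gronwall_tends0 _ rho
    (fun t => 2 * a t * complex.Re (dh t) + 2 * b t * complex.Im (dh t))
    eps (- complex.Re z)) => //.
  - by rewrite oppr_gt0.
  - move=> t t0; have := hr _ t0; have := hi _ t0 => hi' hr'.
    apply: is_derive_eq; rewrite /GRing.scale/= -/(a t) -/(b t).
    by rewrite /a /b; ring.
  - move=> t t0; rewrite hE// !raddfD/= complex_ReM complex_ImM -/(a t) -/(b t).
    rewrite /rho /eps.
    set u := complex.Re (f t); set v := complex.Im (f t).
    set s := complex.Re z; set w := complex.Im z.
    have s0 : 0 < - s by rewrite oppr_gt0.
    set p := (- s)^-1; have p0 : 0 < p by rewrite invr_gt0.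
    have ps : p * s = -1 by rewrite -[s]opprK mulrN mulVf.
    (* As [p * s = -1], expanding [p |f + s h|^2 >= 0] gives the instance of Young's inequality that
       is required. *)
    have : 0 <= p * ((u + s * a t) ^+ 2 + (v + s * b t) ^+ 2).
      by rewrite mulr_ge0 ?addr_ge0 ?sqr_ge0// ltW.
    have -> : p * ((u + s * a t) ^+ 2 + (v + s * b t) ^+ 2) =
      p * (u ^+ 2 + v ^+ 2) + 2 * (p * s) * (u * a t + v * b t)
      + (p * s) * s * (a t ^+ 2 + b t ^+ 2) by ring.
    by rewrite ps; lra.
  - by move=> t; rewrite addr_ge0 ?sqr_ge0.
split; apply: tends0_sqr; apply: tends0_le rho0 => t.
  by rewrite sqr_ge0/= lerDl sqr_ge0.
by rewrite sqr_ge0/= lerDr sqr_ge0.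
Qed.
End ComplexTends.

(** * Matrix preliminaries *)

Lemma unitmx_inj (F : fieldType) n (M : 'M[F]_n) :
  (forall x : 'cV_n, M *m x = 0 -> x = 0) -> M \in unitmx.
Proof.
move=> Minj; rewrite -unitmx_tr -row_free_unit -kermx_eq0.
apply/rowV0P => v /sub_kermxP vM; apply: trmx_inj; rewrite trmx0.
by apply: Minj; apply: trmx_inj; rewrite trmx_mul trmxK vM trmx0.
Qed.

Lemma mxDE (V : nmodType) m n (M N : 'M[V]_(m, n)) i j :
  (M + N) i j = M i j + N i j.
Proof. by rewrite mxE. Qed.

Lemma mxBE (V : zmodType) m n (M N : 'M[V]_(m, n)) i j :
  (M - N) i j = M i j - N i j.
Proof. by rewrite !mxE. Qed.

Lemma mxZE (F : pzRingType) m n (a : F) (M : 'M[F]_(m, n)) i j :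
  (a *: M) i j = a * M i j.
Proof. by rewrite mxE. Qed.

Lemma mem_eigenvaluesP (C : numClosedFieldType) n (M : 'M[C]_n) z :
  reflect (exists2 u : 'cV_n, u != 0 & M *m u = z *: u) (z \in eigenvalues M).
Proof.
rewrite -root_prod_XsubC -eigenvaluesE.
(* [eigenvalue] speaks of row vectors, the statement of columns. *)
have -> : char_poly M = char_poly M^T.
  rewrite /char_poly -det_tr; congr (\det _).
  by apply/matrixP => i j; rewrite !mxE eq_sym.
rewrite -eigenvalue_root_char.
apply: (iffP eigenvalueP) => [[v vM v0]|[u u0 Mu]].
  exists v^T; first by rewrite -[0]trmx0 (inj_eq trmx_inj).
  by apply: trmx_inj; rewrite trmx_mul trmxK vM linearZ /= trmxK.
exists u^T; last by rewrite -[0]trmx0 (inj_eq trmx_inj).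
by rewrite -trmx_mul Mu linearZ.
Qed.

Lemma Cayley_Hamilton_prod (F : fieldType) n (M : 'M[F]_n) s :
  char_poly M = \prod_(z <- s) ('X - z%:P) ->
  foldr (fun z N => (M - z%:M) *m N) 1%:M s = 0.
Proof.
case: n M => [|n] M cM; first by apply/matrixP => -[].
have <- : horner_mx M (char_poly M) = 0 by exact: Cayley_Hamilton.
rewrite cM; elim: s {cM} => [|z s IHs] /=.
  by rewrite big_nil horner_mx_C.
by rewrite big_cons rmorphM rmorphB/= horner_mx_X horner_mx_C IHs.
Qed.

(** * Complexification of real matrices and entrywise derivatives *)

Section ToC.
Variable R : realType.

Lemma toCM m n p (M : 'M[R]_(m, n)) (N : 'M[R]_(n, p)) :
  toC (M *m N) = toC M *m toC N.
Proof. exact: map_mxM. Qed.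

Lemma toCD m n (M N : 'M[R]_(m, n)) : toC (M + N) = toC M + toC N.
Proof. exact: map_mxD. Qed.

Lemma toCB m n (M N : 'M[R]_(m, n)) : toC (M - N) = toC M - toC N.
Proof. exact: map_mxB. Qed.

Lemma toC0 m n : toC (0 : 'M[R]_(m, n)) = 0.
Proof. exact: map_mx0. Qed.

Lemma toC1 n : toC (1%:M : 'M[R]_n) = 1%:M.
Proof. exact: map_mx1. Qed.

Lemma toCT m n (M : 'M[R]_(m, n)) : toC M^T = (toC M)^T.
Proof. by apply/matrixP => i j; rewrite !mxE. Qed.

Lemma toC_inj m n : injective (@toC R m n).
Proof.
move=> M N /matrixP MN; apply/matrixP => i j.
by have := MN i j; rewrite !mxE => /complexI.
Qed.

Lemma ReMtoC m n p (l : 'M[R[i]]_(m, n)) (v : 'M[R]_(n, p)) i j :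
  complex.Re ((l *m toC v) i j) = (map_mx (@complex.Re R) l *m v) i j.
Proof.
rewrite !mxE raddf_sum; apply: eq_bigr => k _; rewrite !mxE.
by case: (l i k) => a b /=; rewrite mulr0 subr0.
Qed.

Lemma ImMtoC m n p (l : 'M[R[i]]_(m, n)) (v : 'M[R]_(n, p)) i j :
  complex.Im ((l *m toC v) i j) = (map_mx (@complex.Im R) l *m v) i j.
Proof.
rewrite !mxE raddf_sum; apply: eq_bigr => k _; rewrite !mxE.
by case: (l i k) => a b /=; rewrite mulr0 add0r.
Qed.
End ToC.

Definition mx_derive (R : realType) n (x : R -> 'cV[R]_n) (t : R)
    (dx : 'cV[R]_n) : Prop :=
  forall i : 'I_n, is_derive t 1 (fun s => x s i 0) (dx i 0).

Lemma mx_deriveM (R : realType) m n (M : 'M[R]_(m, n)) x t dx :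
  mx_derive x t dx -> mx_derive (fun s => M *m x s) t (M *m dx).
Proof.
move=> xd i.
have -> : (fun s => (M *m x s) i 0) = \sum_(j < n) (fun s => M i j * x s j 0).
  by apply/funext => s; rewrite fct_sumE mxE.
rewrite mxE; apply: is_derive_sum => j.
have := xd j => xdj; exact: is_deriveZ.
Qed.

Lemma mx_derive_col_mx (R : realType) m n (x y : R -> _) t dx dy :
  @mx_derive R m x t dx -> @mx_derive R n y t dy ->
  mx_derive (fun s => col_mx (x s) (y s)) t (col_mx dx dy).
Proof.
move=> xd yd i; rewrite mxE; under eq_fun do rewrite mxE.
by case: (fintype.split i).
Qed.

Lemma derive_eq0 (R : realType) (f : R -> R) (t df : R) : 0 < t ->
  (forall s, 0 < s -> f s = 0) -> is_derive t 1 f df -> df = 0.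
Proof.
move=> t0 f0 fd; rewrite -(@derive_val _ _ _ _ _ _ _ fd).
rewrite (near_eq_derive (g := cst 0)) ?derive_cst//.
by near=> s; rewrite f0//; near: s; exact: lt_nbhsr.
Unshelve. all: by end_near. Qed.

(** * Differential-algebraic systems [E x' = K x] *)

(* With [J = (E - K)^-1 E] the system reads [x = J (x - x')].  By
   Cayley-Hamilton a product of factors [J - z], over the eigenvalues [z] of
   [J], annihilates [x]; the factors are peeled off one at a time, those with
   [z = 0] first. *)
Section Pencil.
Variables (R : realType) (n : nat) (E K : 'M[R]_n).
Variables (x dx : R -> 'cV[R]_n).
Hypothesis xd : forall t, 0 < t -> mx_derive x t (dx t).
Hypothesis ExK : forall t, 0 < t -> E *m dx t = K *m x t.
Hypothesis spec : forall (z : R[i]) (u : 'cV[R[i]]_n), 0 <= complex.Re z ->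
  z *: (toC E *m u) = toC K *m u -> u = 0.

(** A kernel vector of [E - K] is an eigenvector of the pencil for [z = 1], which [spec]
    excludes. *)
Let EK_unit : E - K \in unitmx.
Proof.
apply: unitmx_inj => u; rewrite mulmxBl => /subr0_eq Eu.
apply: (@toC_inj R); rewrite toC0; apply: (spec (z := 1)) => /=.
  exact: ler01.
by rewrite scale1r -!toCM Eu.
Qed.

Let J := invmx (E - K) *m E.

Let xJ t : 0 < t -> x t = J *m x t - J *m dx t.
Proof.
move=> t0; rewrite -mulmxBr -mulmxA mulmxBr ExK// -mulmxBl.
by rewrite mulmxA mulVmx// mul1mx.
Qed.

(** [J u = z u] amounts to [K u = (1 - z^-1) E u], so [spec] can be applied at [1 - z^-1]. *)
Let eigenJ (z : R[i]) (u : 'cV[R[i]]_n) : z != 0 ->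
  toC J *m u = z *: u -> u != 0 -> complex.Re (1 - z^-1) < 0.
Proof.
move=> z0 Ju; apply: contraNT; rewrite -leNgt => rez; apply/eqP.
apply: (spec rez).
have Eu : toC E *m u = z *: (toC E *m u - toC K *m u).
  have : toC (E - K) *m (toC J *m u) = toC (E - K) *m (z *: u) by rewrite Ju.
  rewrite mulmxA -toCM /J mulmxA mulmxV// mul1mx => {1}->.
  by rewrite -scalemxAr toCB mulmxBl.
rewrite scalerBl scale1r [X in _ - _ *: X]Eu scalerA mulVf// scale1r.
by rewrite opprB addrC subrK.
Qed.

Local Notation lx l := (fun t => (l *m toC (x t)) 0 0).

Let Re_deriv (l : 'rV[R[i]]_n) (t : R) : 0 < t ->
  is_derive t 1 (fun s => complex.Re ((l *m toC (x s)) 0 0))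
    (complex.Re ((l *m toC (dx t)) 0 0)).
Proof.
move=> t0; under eq_fun do rewrite ReMtoC.
by rewrite ReMtoC; exact: mx_deriveM (xd t0) 0.
Qed.

Let Im_deriv (l : 'rV[R[i]]_n) (t : R) : 0 < t ->
  is_derive t 1 (fun s => complex.Im ((l *m toC (x s)) 0 0))
    (complex.Im ((l *m toC (dx t)) 0 0)).
Proof.
move=> t0; under eq_fun do rewrite ImMtoC.
by rewrite ImMtoC; exact: mx_deriveM (xd t0) 0.
Qed.

Let ldxJ (l : 'rV[R[i]]_n) t : 0 < t ->
  (l *m toC J *m toC (dx t)) 0 0 =
  (l *m toC J *m toC (x t)) 0 0 - (l *m toC (x t)) 0 0.
Proof.
move=> t0.
have -> : l *m toC (x t) = l *m toC J *m toC (x t) - l *m toC J *m toC (dx t).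
  by rewrite -!mulmxA -mulmxBr -!toCM -toCB -xJ.
by rewrite mxBE opprB addrC subrK.
Qed.

(** Differentiating [l J x = 0] gives [l J x' = 0], and [l x = l J (x - x')]. *)
Let zero_step (l : 'rV[R[i]]_n) :
  (forall t, 0 < t -> (l *m toC J *m toC (x t)) 0 0 = 0) ->
  (forall t, 0 < t -> (l *m toC (x t)) 0 0 = 0).
Proof.
move=> lJ0 t t0; have := ldxJ l t0; rewrite lJ0// sub0r => lx.
apply/eqP; rewrite -oppr_eq0 -lx; apply/eqP.
have dr := Re_deriv (l *m toC J) t0; have di := Im_deriv (l *m toC J) t0.
apply/eqP; rewrite eq_complex; apply/andP; split; apply/eqP.
  by apply: derive_eq0 t0 _ dr => s s0; rewrite lJ0.
by apply: derive_eq0 t0 _ di => s s0; rewrite lJ0.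
Qed.

Let eig_step (l : 'rV[R[i]]_n) (z : R[i]) : z != 0 ->
  complex.Re (1 - z^-1) < 0 ->
  ctends0 (lx (l *m (toC J - z%:M))) -> ctends0 (lx l).
Proof.
move=> z0 rez w0.
(* [h = l J x] satisfies [h' = (1 - z^-1) h + z^-1 w], [w = l (J - z) x]. *)
have wE t : (l *m (toC J - z%:M) *m toC (x t)) 0 0 =
    (l *m toC J *m toC (x t)) 0 0 - z * (l *m toC (x t)) 0 0.
  by rewrite mulmxBr mulmxBl mul_mx_scalar -scalemxAl mxBE mxZE.
have h0 : ctends0 (lx (l *m toC J)).
  apply: (@scalar_ode_tends0 _ _ (fun t => (l *m toC J *m toC (dx t)) 0 0)
    (fun t => z^-1 * (l *m (toC J - z%:M) *m toC (x t)) 0 0)) rez _ _ _ _.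
  - by move=> t; exact: Re_deriv.
  - by move=> t; exact: Im_deriv.
  - by move=> t t0; rewrite ldxJ// wE mulrBr mulrA mulVf//; ring.
  - exact: ctends0Z.
have -> : lx l = (fun t => z^-1 * ((l *m toC J *m toC (x t)) 0 0 -
    (l *m (toC J - z%:M) *m toC (x t)) 0 0)).
  by apply/funext => t; rewrite wE opprB addrC subrK mulrA mulVf// mul1r.
exact/ctends0Z/ctends0B.
Qed.

Let Jprod (s : seq R[i]) : 'M[R[i]]_n :=
  foldr (fun z M => (toC J - z%:M) *m M) 1%:M s.

Let zero_steps (l : 'rV[R[i]]_n) s : all (pred1 0) s ->
  (forall t, 0 < t -> (l *m Jprod s *m toC (x t)) 0 0 = 0) ->
  (forall t, 0 < t -> (l *m toC (x t)) 0 0 = 0).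
Proof.
elim: s l => [|z s IHs] l /=; first by rewrite mulmx1.
move=> /andP[/eqP-> s0]; rewrite raddf0 subr0 mulmxA => lJs.
exact/zero_step/IHs.
Qed.

Let eig_steps (l : 'rV[R[i]]_n) s :
  all (fun z => (z != 0) && (complex.Re (1 - z^-1) < 0)) s ->
  ctends0 (lx (l *m Jprod s)) -> ctends0 (lx l).
Proof.
elim: s l => [|z s IHs] l /=; first by rewrite mulmx1.
move=> /andP[/andP[z0 rez] s0]; rewrite mulmxA => lJs.
exact/(eig_step z0 rez)/IHs.
Qed.

Lemma pencil_tends0 i : x t i 0 @[t --> +oo] --> (0 : R).
Proof.
pose s := eigenvalues (toC J).
pose nz := [seq z <- s | z != 0]; pose zs := [seq z <- s | ~~ (z != 0)].
(* The factors [J] are removed by differentiation, which needs a function that vanishes identically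
   and not merely in the limit. Hence [zs] stands on the right, where peeling starts. *)
have JE : Jprod (nz ++ zs) = 0.
  apply: Cayley_Hamilton_prod; rewrite eigenvaluesE.
  by apply: perm_big; rewrite perm_sym perm_filterC.
have JM s1 s2 : Jprod (s1 ++ s2) = Jprod s1 *m Jprod s2.
  by elim: s1 => [|z s1 IH]/=; rewrite ?mul1mx// IH mulmxA.
have nz_neg : all (fun z => (z != 0) && (complex.Re (1 - z^-1) < 0)) nz.
  apply/allP => z; rewrite mem_filter => /andP[z0 zs'].
  rewrite z0/=; have /mem_eigenvaluesP[u u0 Ju] := zs'.
  exact: eigenJ z0 Ju u0.
pose l : 'rV[R[i]]_n := delta_mx 0 i.
have [] : ctends0 (lx l).
  apply: (eig_steps nz_neg).
  have lz : forall t, 0 < t -> (l *m Jprod nz *m toC (x t)) 0 0 = 0.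
    apply: (@zero_steps _ zs) => [|t _].
      by apply/allP => z; rewrite mem_filter negbK => /andP[].
    by rewrite -[l *m _ *m _]mulmxA -JM JE mulmx0 mul0mx mxE.
  by split; apply: tends0_eq0 => t t0; rewrite lz.
move=> + _; apply: cvg_trans.
apply: near_eq_cvg; near=> t.
by rewrite -rowE !mxE.
Unshelve. all: by end_near. Qed.
End Pencil.

(** * Second-order systems *)

Lemma mx_tends0M (R : realType) m n (M : 'M[R]_(m, n)) (x : R -> 'cV[R]_n) :
    (forall j, x t j 0 @[t --> +oo] --> (0 : R)) ->
  forall i, (M *m x t) i 0 @[t --> +oo] --> (0 : R).
Proof.
move=> x0 i.
have -> : (fun t => (M *m x t) i 0) =
    \sum_(j < n) (fun t => M i j * x t j 0 + 0 * x t j 0).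
  apply/funext => s; rewrite fct_sumE mxE.
  by apply: eq_bigr => j _; rewrite mul0r addr0.
elim/big_ind: _ => [|f g f0 g0|j _]; first exact: cvg_cst.
  by have := cvgD f0 g0; rewrite addr0; apply.
exact: tends0_lincomb.
Qed.

Lemma toC_ctr (R : realType) m n (M : 'M[R]_(m, n)) : (toC M)^t* = toC M^T.
Proof.
by apply/matrixP => i j; rewrite !mxE; exact: conjc_real.
Qed.

(* The state is [(e', S e)], where [Q = U S] is a full rank factorization:
   replacing [e] by [S e] discards the constant solutions in the kernel of
   [Q], which would be eigenvectors of the pencil for the eigenvalue 0. *)
Lemma second_order_tends0 (R : realType) n m (M G Q : 'M[R]_n)
    (C : 'M[R]_(m, n)) (e e1 e2 : R -> 'cV[R]_n) :
    (forall t : R, 0 < t -> mx_derive e t (e1 t)) ->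
    (forall t : R, 0 < t -> mx_derive e1 t (e2 t)) ->
    (forall t, 0 < t -> M *m e2 t + G *m e1 t + Q *m e t = 0) ->
    Q^T = Q -> (C <= Q)%MS ->
    (forall z (f : 'cV[R[i]]_n), z != 0 -> 0 <= complex.Re z ->
      z ^+ 2 *: (toC M *m f) + z *: (toC G *m f) + toC Q *m f = 0 -> f = 0) ->
    (forall f : 'cV[R[i]]_n,
      toC Q *m f = 0 -> f^t* *m toC G *m f = 0 -> f = 0) ->
  forall i, (C *m e t) i 0 @[t --> +oo] --> (0 : R).
Proof.
move=> ed e1d eqn Qsym CQ nz_spec z_spec.
pose S := row_base Q; pose U := col_base Q.
have QE : Q = U *m S by rewrite mulmx_base.
have /row_freeP[S' SS'] : row_free S by exact: row_base_free.
have /row_fullP[U' UU'] : row_full U by exact: col_base_full.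
have [D CE] : exists D, C = D *m S by apply/submxP; rewrite eq_row_base.
pose E := block_mx M 0 0 (1%:M : 'M[R]_(\rank Q)).
pose K := block_mx (- G) (- U) S 0.
have x0 : forall i, (col_mx (e1 t) (S *m e t)) i 0 @[t --> +oo] --> (0 : R).
  apply: (@pencil_tends0 _ _ E K _ (fun t => col_mx (e2 t) (S *m e1 t))).
  - move=> t t0; apply: mx_derive_col_mx; first exact: e1d.
    exact/mx_deriveM/ed.
  - move=> t t0; rewrite !mul_block_col !mul0mx addr0 add0r mul1mx addr0.
    congr col_mx; rewrite !mulNmx mulmxA -QE -opprD; apply/eqP.
    by rewrite -addr_eq0 addrA eqn.
  - move=> z u rez; rewrite -(vsubmxK u).
    move: (usubmx u) (dsubmx u) => f r.
    have -> : toC E = block_mx (toC M) 0 0 1%:M.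
      by rewrite /toC /E map_block_mx !map_mx0 map_mx1.
    have -> : toC K = block_mx (- toC G) (- toC U) (toC S) 0.
      by rewrite /toC /K map_block_mx !map_mxN map_mx0.
    rewrite !mul_block_col !mul0mx addr0 add0r mul1mx addr0 scale_col_mx.
    move=> /eq_col_mx[]; rewrite !mulNmx => MGU rS.
    have [S'E U'E] : toC S *m toC S' = 1%:M /\ toC U' *m toC U = 1%:M.
      by rewrite -!toCM SS' UU' !toC1.
    have QEc : toC Q = toC U *m toC S by rewrite -toCM -QE.
    suff f0 : f = 0 /\ r = 0 by case: f0 => -> ->; rewrite col_mx0.
    (* At [z = 0] one has [S f = 0] and [G f = - U r]. Symmetry of [Q] turns [Q f = 0] into
       [f^* U = 0], whence [f^* G f = 0]. *)
    have [z0|z0] := eqVneq z 0.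
      move: MGU rS; rewrite z0 !scale0r => /esym/eqP.
      rewrite subr_eq0 eqr_oppLR => /eqP GU /esym Sf.
      have Qf : toC Q *m f = 0 by rewrite QEc -mulmxA Sf mulmx0.
      have fU : f^t* *m toC U = 0.
        have Qc : (toC Q)^t* = toC Q by rewrite toC_ctr Qsym.
        rewrite -[_ *m _]mulmx1 -S'E mulmxA -[_ *m _ *m toC S]mulmxA -QEc.
        by rewrite -Qc -ctrmx_mul Qf trmx0 map_mx0 mul0mx.
      have f0 : f = 0.
        apply: z_spec => //.
        rewrite -mulmxA -[toC G *m f]opprK GU opprK mulmxN mulmxA fU.
        by rewrite mul0mx oppr0.
      split=> //; move: GU; rewrite f0 mulmx0 => /esym/eqP.
      rewrite oppr_eq0 => /eqP Ur.
      by rewrite -[r]mul1mx -U'E -mulmxA Ur mulmx0.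
    (* Multiplying the first block row by [z] and substituting [z r = S f] eliminates [r] and leaves
       the quadratic eigenvalue problem. *)
    have f0 : f = 0.
      apply: (nz_spec z) => //.
      rewrite expr2 -scalerA MGU QEc -mulmxA -rS -scalemxAr.
      by rewrite -!scalerDr [X in X + _]addrAC addNr add0r addNr scaler0.
    split=> //; move: rS; rewrite f0 mulmx0 => /eqP.
    by rewrite scaler_eq0 (negPf z0) => /eqP.
move=> i.
have -> : (fun t => (C *m e t) i 0) =
    (fun t => (row_mx 0 D *m col_mx (e1 t) (S *m e t)) i 0).
  by apply/funext => t; rewrite mul_row_col mul0mx add0r CE -mulmxA.
exact: mx_tends0M.
Qed.

(** * Positive semidefinite forms and Laplacians *)

Section Psd.
Variable R : realType.

Definition qform n (S : 'M[R]_n) (f : 'cV[R[i]]_n) : R[i] :=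
  (f^t* *m toC S *m f) 0 0.

(* The kernel property follows from symmetry and positivity; as part of the
   definition it spares a Cauchy-Schwarz argument. *)
Definition psd n (S : 'M[R]_n) : Prop :=
  S^T = S /\ forall f, 0 <= qform S f /\ (qform S f = 0 -> toC S *m f = 0).

Lemma qformD n (S T : 'M[R]_n) f : qform (S + T) f = qform S f + qform T f.
Proof. by rewrite /qform toCD mulmxDr mulmxDl mxE. Qed.

Lemma psdD n (S T : 'M[R]_n) : psd S -> psd T -> psd (S + T).
Proof.
move=> [Ss Sp] [Ts Tp]; split; first by rewrite linearD/= Ss Ts.
move=> f; have [[Sf Sf0] [Tf Tf0]] := (Sp f, Tp f); rewrite qformD.
split; first exact: addr_ge0 Sf Tf.
move/eqP; rewrite (paddr_eq0 Sf Tf) toCD mulmxDl.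
by move=> /andP[/eqP/Sf0-> /eqP/Tf0->]; rewrite addr0.
Qed.

Lemma qform_gram n m (D : 'M[R]_(n, m)) f :
  qform (D *m D^T) f = \sum_i `|(toC D^T *m f) i 0| ^+ 2.
Proof.
rewrite /qform toCM -mulmxA -mulmxA mulmxA -{1}[D]trmxK -toC_ctr -ctrmx_mul mxE.
by apply: eq_bigr => i _; rewrite [(_ ^t*) _ _]mxE [_^T _ _]mxE mulrC normCK.
Qed.

Lemma qform_gram_eq0 n m (D : 'M[R]_(n, m)) f :
  qform (D *m D^T) f = 0 -> toC D^T *m f = 0.
Proof.
rewrite qform_gram => /eqP; rewrite psumr_eq0 => [/allP f0|i _]; last first.
  by rewrite exprn_ge0.
apply/colP => i; have := f0 i (mem_index_enum _).
by rewrite expf_eq0 normr_eq0 /= [in RHS]mxE => /eqP.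
Qed.

Lemma psd_gram n m (D : 'M[R]_(n, m)) : psd (D *m D^T).
Proof.
split; first by rewrite trmx_mul trmxK.
move=> f; split.
  by rewrite qform_gram sumr_ge0// => i _; rewrite exprn_ge0.
by move/qform_gram_eq0; rewrite toCM -mulmxA => ->; rewrite mulmx0.
Qed.

Lemma psd_block n1 n2 (S1 : 'M[R]_n1) (S2 : 'M[R]_n2) :
  psd S1 -> psd S2 -> psd (block_mx S1 0 0 S2).
Proof.
move=> [S1s S1p] [S2s S2p]; split; first by rewrite tr_block_mx S1s S2s !trmx0.
move=> f; rewrite -(vsubmxK f); move: (usubmx f) (dsubmx f) => g h.
have [[g0 gE] [h0 hE]] := (S1p g, S2p h).
have toCb : toC (block_mx S1 0 0 S2) = block_mx (toC S1) 0 0 (toC S2).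
  by rewrite /toC map_block_mx !map_mx0.
have -> : qform (block_mx S1 0 0 S2) (col_mx g h) = qform S1 g + qform S2 h.
  rewrite /qform toCb tr_col_mx map_row_mx mul_row_block !mulmx0 add0r addr0.
  by rewrite mul_row_col mxE.
split; first exact: addr_ge0 g0 h0.
move/eqP; rewrite (paddr_eq0 g0 h0) toCb mul_block_col !mul0mx add0r addr0.
by move=> /andP[/eqP/gE-> /eqP/hE->]; rewrite col_mx0.
Qed.

Lemma laplacian_mulE n (W L : 'M[R]_n) (f : 'cV[R[i]]_n) r :
  L = \matrix_(r, s) (if r == s then \sum_(k | k != r) W r k else - W r s) ->
  (toC L *m f) r 0 = \sum_k (W r k)%:C%C * (f r 0 - f k 0).
Proof.
move=> ->; rewrite mxE (bigD1 r)//= [RHS](bigD1 r)//= subrr mulr0 add0r.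
rewrite !mxE eqxx rmorph_sum/= mulr_suml -big_split/=.
apply: eq_bigr => k kr; rewrite !mxE eq_sym (negPf kr) rmorphN/= mulNr.
by rewrite mulrBr.
Qed.

Lemma laplacian_const n (L : 'M[R]_n) :
  laplacian L -> L *m const_mx 1 = 0 :> 'cV_n.
Proof.
move=> [W [_ _ LE]]; apply: (@toC_inj R); apply/colP => r.
rewrite toCM (laplacian_mulE _ _ LE) toC0 [RHS]mxE big1// => k _.
by rewrite !mxE subrr mulr0.
Qed.

(** The form is the Dirichlet energy, half the sum of [W r k |f r - f k|^2]. If it vanishes, so does
    every [W r k (f r - f k)], and these add up to the entries of [L f]. *)
Lemma psd_laplacian n (L : 'M[R]_n) : laplacian L -> psd L.
Proof.
move=> [W [Wsym W0 LE]].
have WE r k : W r k = W k r by rewrite -[in LHS]Wsym mxE.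
split.
  apply/matrixP => r k; rewrite LE !mxE eq_sym.
  by case: eqVneq => [->|_]//; rewrite WE.
move=> f; pose F r k := (W r k)%:C%C * `|f r 0 - f k 0| ^+ 2.
have F0 r k : 0 <= F r k by rewrite mulr_ge0 ?exprn_ge0// ler0c.
have qE : qform L f = 2^-1 * \sum_r \sum_k F r k.
  have qf : qform L f =
      \sum_r \sum_k (W r k)%:C%C * ((f r 0)^* * (f r 0 - f k 0)).
    rewrite /qform -mulmxA mxE; apply: eq_bigr => r _.
    rewrite (laplacian_mulE _ _ LE) !mxE mulr_sumr; apply: eq_bigr => k _.
    by rewrite mulrCA.
  rewrite -[LHS](mulKf (x := 2)) ?pnatr_eq0//; congr (_ * _).
  (* Adding the copy with [r] and [k] exchanged completes the square of [f r - f k]. *)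
  have qf' := qf; rewrite exchange_big/= in qf'.
  rewrite mulr_natl mulr2n {1}qf qf' -big_split/=.
  apply: eq_bigr => r _; rewrite -big_split/=; apply: eq_bigr => k _.
  rewrite WE -mulrDr /F WE; congr (_ * _).
  rewrite normCK rmorphB/=. ring.
split.
  rewrite qE mulr_ge0 ?invr_ge0 ?ler0n// sumr_ge0// => r _.
  exact: sumr_ge0.
rewrite qE => /eqP; rewrite mulf_eq0 invr_eq0 pnatr_eq0/= psumr_eq0 => [|r _];
  last exact: sumr_ge0.
move=> /allP Fr; apply/colP => r; rewrite (laplacian_mulE _ _ LE) [RHS]mxE.
have := Fr r (mem_index_enum _); rewrite /= psumr_eq0// => /allP Frk.
apply: big1 => k _; apply/eqP; have := Frk k (mem_index_enum _).
by rewrite /= /F !mulf_eq0 normr_eq0 orbb.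
Qed.
End Psd.

Lemma ge0_complexE (R : realType) (z : R[i]) :
  0 <= z -> z = (complex.Re z)%:C%C /\ 0 <= complex.Re z.
Proof. by case: z => a b; rewrite lecE /= => /andP[/eqP-> ->]. Qed.

(** Nonnegative complex numbers are real, so real and imaginary parts can be compared. *)
Lemma add_imaginary_inj (R : realType) (g b a : R[i]) (m : R) :
    0 <= g -> 0 <= b -> 0 <= a -> g + 'i%C * b = 'i%C * m%:C%C * a ->
  g = 0 /\ b = m%:C%C * a.
Proof.
move=> /ge0_complexE[-> _] /ge0_complexE[-> _] /ge0_complexE[-> _].
move: (complex.Re g) (complex.Re b) (complex.Re a) => {}g {}b {}a /eqP.
rewrite eq_complex /= !(mul0r, mulr0, mul1r, subr0, addr0, add0r) oppr0.
by move=> /andP[/eqP-> /eqP->]; rewrite rmorphM.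
Qed.

(** * The effective Laplacian *)

Section Effective.
Variables (R : realType) (n q : nat).
Variables (A : 'M[R]_(n, q)) (G B : 'M[R]_n).
Hypotheses (Gpsd : psd G) (Bpsd : psd B) (Arank : \rank A = q).

Let L : 'M[R[i]]_n := toC G + 'i%C *: toC B.
Let Y := effective_laplacian A G B.

Lemma toC_col_inj p (X : 'M[R[i]]_(q, p)) : toC A *m X = 0 -> X = 0.
Proof.
have /row_fullP[A' AA'] : row_full A by rewrite /row_full Arank.
move=> AX; rewrite -[X]mul1mx -[1%:M](@toC1 R) -AA' toCM -mulmxA AX.
by rewrite mulmx0.
Qed.

Lemma admittance_formE (f : 'cV[R[i]]_n) :
  (f^t* *m L *m f) 0 0 = qform G f + 'i%C * qform B f.
Proof.
by rewrite mulmxDr mulmxDl -scalemxAr -scalemxAl mxE [in X in _ + X]mxE.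
Qed.

Lemma admittance_form_eq0 (f : 'cV[R[i]]_n) :
  f^t* *m L *m f = 0 -> toC G *m f = 0 /\ toC B *m f = 0.
Proof.
move=> /matrixP/(_ 0 0).
rewrite admittance_formE mxE.
have [[g0 gE] [b0 bE]] := (Gpsd.2 f, Bpsd.2 f).
move=> gb0; suff [qg qb] : qform G f = 0 /\ qform B f = 0.
  by split; [exact: gE | exact: bE].
have gb : qform G f + 'i%C * qform B f = 'i%C * (0 : R)%:C%C * 0.
  by rewrite mulr0.
have [-> ->] := add_imaginary_inj g0 b0 (lexx 0) gb.
by rewrite mulr0.
Qed.

(** The columns of [X] are node potentials realizing unit oscillator voltages, those of [Y] the
    corresponding oscillator currents. Stacked, they are the pseudoinverse applied to [col_mx 0 1],
    an exact solution because these columns lie in the range of the block matrix. *)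
Lemma effective_laplacian_potential :
  exists X : 'M[R[i]]_(n, q), L *m X = toC A *m Y /\ (toC A)^T *m X = 1%:M.
Proof.
pose M := block_mx L (- toC A) (toC A)^T 0.
have [MPM _ _ _] := mpinvP M.
have Lker (f : 'cV[R[i]]_n) : f^t* *m L *m f = 0 -> f^t* *m L = 0.
  move=> /admittance_form_eq0[Gf Bf].
  have ctr0 (S : 'M[R]_n) : S^T = S -> toC S *m f = 0 -> f^t* *m toC S = 0.
    move=> Ss Sf; rewrite -[in LHS]Ss -toC_ctr -ctrmx_mul Sf.
    by rewrite trmx0 map_mx0.
  by rewrite /L mulmxDr -scalemxAr (ctr0 G) ?(ctr0 B) ?scaler0 ?addr0//;
    [case: Bpsd | case: Gpsd].
(* [K] annihilates [M] on the left, which forces its last [q] columns to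
   vanish; hence the columns of [col_mx 0 1] are in the range of [M]. *)
pose K := 1%:M - M *m mpinv M.
have KM : K *m M = 0 by rewrite mulmxBl MPM mul1mx subrr.
have K2 : rsubmx K = 0.
  move: KM; rewrite -(hsubmxK K) row_mxKr.
  move: (lsubmx K) (rsubmx K) => K1 K2.
  rewrite mul_row_block mulmx0 addr0 mulmxN -row_mx0 => /eq_row_mx[KL KA].
  have {}KA : K1 *m toC A = 0 by apply/eqP; rewrite -oppr_eq0 KA.
  have {}KL : K1 *m L = - (K2 *m (toC A)^T).
    by apply/eqP; rewrite -addr_eq0 KL.
  have AT : (toC A)^T = (toC A)^t* by rewrite toC_ctr toCT.
  (* The diagonal entries are the values of the admittance form at the adjoints of the rows of [K1],
     so [Lker] applies row by row. *)
  have KLK : K1 *m L *m K1^t* = 0.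
    by rewrite KL mulNmx -mulmxA AT -ctrmx_mul KA trmx0 map_mx0 mulmx0 oppr0.
  have K1L : K1 *m L = 0.
    apply/row_matrixP => i; rewrite row0 row_mul.
    have fE : row i K1 = ((row i K1)^t*)^t* by rewrite ctrmxK.
    rewrite fE; apply: Lker; rewrite -fE -row_mul.
    apply/matrixP => a b; transitivity ((K1 *m L *m K1^t*) i i).
      by rewrite [LHS]mxE [RHS]mxE; apply: eq_bigr => k _; rewrite !mxE.
    by rewrite KLK !mxE.
  apply: trmx_inj; rewrite trmx0; apply: toC_col_inj; apply: trmx_inj.
  rewrite trmx_mul trmxK trmx0; apply/eqP.
  by rewrite -oppr_eq0 -KL K1L.
have Kb : M *m (mpinv M *m col_mx 0 1%:M) = col_mx (0 : 'M[R[i]]_(n, q)) 1%:M.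
  apply/eqP; rewrite eq_sym -subr_eq0 mulmxA -[X in X - _]mul1mx -mulmxBl -/K.
  by rewrite -(hsubmxK K) K2 mul_row_col mul0mx mulmx0 addr0.
move: Kb; set Z := mpinv M *m _.
have YE : Y = dsubmx Z.
  rewrite /Y /effective_laplacian -/L -/M -mulmxA -/Z -{1}(vsubmxK Z).
  by rewrite mul_row_col mul0mx mul1mx add0r.
rewrite -{1}(vsubmxK Z) -YE mul_block_col mul0mx addr0.
move=> /eq_col_mx[LX AX]; exists (usubmx Z); split=> //.
by apply/eqP; rewrite -subr_eq0 -mulNmx LX.
Qed.

(** For the converse, [d = f - X u] satisfies [A^T d = 0], so [d^* L d = d^* A (w - Y u) = 0]. Then
    [L d = 0], and injectivity of [A] gives [w = Y u]. *)
Lemma effective_laplacianP (u w : 'cV[R[i]]_q) :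
  Y *m u = w <-> exists f, (toC A)^T *m f = u /\ L *m f = toC A *m w.
Proof.
have [X [LX AX]] := effective_laplacian_potential.
split=> [<-|[f [Af Lf]]].
  exists (X *m u); split; first by rewrite mulmxA AX mul1mx.
  by rewrite mulmxA LX -mulmxA.
pose d := f - X *m u.
have Ad : (toC A)^T *m d = 0 by rewrite mulmxBr Af mulmxA AX mul1mx subrr.
have Ld : L *m d = toC A *m (w - Y *m u) 
  by rewrite mulmxBr Lf mulmxA LX -mulmxA -mulmxBr.
have [Gd Bd] : toC G *m d = 0 /\ toC B *m d = 0.
  apply: admittance_form_eq0; rewrite -mulmxA Ld mulmxA.
  rewrite -[toC A](@ctrmxK) toC_ctr toCT -ctrmx_mul Ad trmx0 map_mx0.
  by rewrite mul0mx.
have /toC_col_inj/eqP : toC A *m (w - Y *m u) = 0.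
  by rewrite -Ld mulmxDl -scalemxAl Gd Bd scaler0 addr0.
by rewrite subr_eq0 => /eqP ->.
Qed.

(** With [X] the potentials of [effective_laplacian_potential], [1^T Y = p^T A Y = p^T L X = 0]. *)
Lemma effective_laplacian_sum0 (p : 'cV[R]_n) :
  G *m p = 0 -> B *m p = 0 -> A^T *m p = const_mx 1 ->
  (const_mx 1 : 'rV_q) *m Y = 0.
Proof.
move=> Gp Bp Ap; have [X [LX AX]] := effective_laplacian_potential.
have <- : (toC p)^T *m toC A = const_mx 1.
  apply: trmx_inj; rewrite trmx_mul trmxK -toCT -toCM Ap.
  by apply/matrixP => i j; rewrite !mxE.
rewrite -mulmxA -LX mulmxA.
suff -> : (toC p)^T *m L = 0 by rewrite mul0mx.
have sym0 (S : 'M[R]_n) : S^T = S -> S *m p = 0 -> (toC p)^T *m toC S = 0.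
  by move=> Ss Sp; rewrite -toCT -toCM -[S]Ss -trmx_mul Sp trmx0 toC0.
by rewrite mulmxDr -scalemxAr (sym0 G) ?(sym0 B) ?scaler0 ?addr0//;
  [case: Bpsd | case: Gpsd].
Qed.
End Effective.

(** * Counting imaginary eigenvalues *)

(** Brauer's theorem for a left null vector: the update replaces one root 0 by [r c], the other
    roots staying in place. *)
Lemma char_poly_rank1_update (F : fieldType) n (M : 'M[F]_n)
    (c : 'cV[F]_n) (r : 'rV[F]_n) : r *m M = 0 ->
  'X * char_poly (M + c *m r) = char_poly M * ('X - ((r *m c) 0 0)%:P).
Proof.
move=> rM.
(* Evaluate the determinant of [D] by clearing first [cx], then [rx]. *)
pose Mx := char_poly_mx M; pose cx := map_mx polyC c; pose rx := map_mx polyC r.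
pose D := block_mx Mx cx rx 1%:M.
have detD : \det D = char_poly (M + c *m r).
  rewrite -[LHS]mul1r.
  have <- : \det (block_mx 1%:M (- cx) 0 (1%:M : 'M[{poly F}]_1)) = 1.
    by rewrite det_ublock !det1 mulr1.
  rewrite -det_mulmx mulmx_block !mul1mx !mul0mx !add0r mulmx1 subrr.
  rewrite det_lblock det1 mulr1 mulNmx; congr (\det _).
  by rewrite /Mx /char_poly_mx map_mxD map_mxM opprD addrA.
rewrite -detD.
have detX : \det (block_mx 1%:M 0 (- rx) ('X%:M : 'M[{poly F}]_1)) = 'X.
  by rewrite det_lblock det1 mul1r det_scalar1.
rewrite -{1}detX -det_mulmx mulmx_block !mul1mx !mul0mx !addr0 mulmx1.
have -> : - rx *m Mx + 'X%:M *m rx = 0.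
  rewrite mul_scalar_mx mulmxBr mulNmx mul_mx_scalar mulNmx opprK -map_mxM rM.
  by rewrite map_mx0 addr0 addNr.
rewrite det_ublock; congr (_ * _).
rewrite mulNmx -map_mxM det_mx11 mxE addrC; congr (_ + _).
  by rewrite mxE eqxx mulr1n.
by rewrite [LHS]mxE [in LHS]mxE.
Qed.

Lemma eigenvalues_rank1_update (C : numClosedFieldType) n (M : 'M[C]_n)
    (c : 'cV[C]_n) (r : 'rV[C]_n) : r *m M = 0 ->
  perm_eq (0 :: eigenvalues (M + c *m r)) ((r *m c) 0 0 :: eigenvalues M).
Proof.
move=> rM; apply: prod_XsubC_eq; rewrite !big_cons -!eigenvaluesE subr0.
by rewrite char_poly_rank1_update// mulrC.
Qed.

Section Count.
Variable R : realType.

(** The update by [r^T r] moves one eigenvalue 0 to [k], off the axis. What remains is that [N] has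
    no imaginary eigenvalue, which eigenvectors detect without regard to multiplicity; as
    [r N = k r], those for an eigenvalue other than [k] are killed by [r] and are eigenvectors of
    [M]. *)
Lemma nb_imaginary_eigenvalues_eq1 n (M : 'M[R[i]]_n) (r : 'rV[R[i]]_n) :
    r *m M = 0 -> 0 < complex.Re ((r *m r^T) 0 0) ->
  nb_imaginary_eigenvalues M = 1%N <->
  (forall (u : 'cV_n) z, complex.Re z = 0 -> r *m u = 0 -> M *m u = z *: u ->
    u = 0).
Proof.
move=> rM rr0; pose c := r^T; pose N := M + c *m r; pose k := (r *m c) 0 0.
have perm_ev := eigenvalues_rank1_update c rM.
have nbMN : nb_imaginary_eigenvalues M = (nb_imaginary_eigenvalues N).+1.
  have /permP/(_ (fun z => complex.Re z == 0))/= := perm_ev.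
  by rewrite eqxx (gt_eqF rr0) add0n add1n.
have kM (u : 'cV_n) : r *m (N *m u) = k *: (r *m u).
  rewrite /N mulmxDl mulmxDr mulmxA rM mul0mx add0r -mulmxA mulmxA.
  by rewrite [r *m c]mx11_scalar mul_scalar_mx.
rewrite nbMN; split.
  move=> /succn_inj/eqP; rewrite -leqn0 leqNgt -has_count => /hasPn nN.
  move=> u z z0 ru Mu.
  apply/eqP; apply: contraT => u0.
  have /nN : z \in eigenvalues N.
    apply/mem_eigenvaluesP; exists u => //.
    by rewrite /N mulmxDl Mu -mulmxA ru mulmx0 addr0.
  by rewrite z0 eqxx.
move=> Mspec; congr S; apply/eqP; rewrite -leqn0 leqNgt -has_count.
apply/hasPn => z /mem_eigenvaluesP[u u0 Nu]; apply/eqP => z0.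
have ru : r *m u = 0.
  have := kM u; rewrite Nu -scalemxAr => /eqP.
  rewrite -subr_eq0 -scalerBl scaler_eq0 subr_eq0 => /orP[/eqP zk|/eqP//].
  by move: rr0; rewrite -/c -/k -zk z0 ltxx.
move/eqP: u0; apply; apply: (Mspec u z z0 ru).
by rewrite -Nu /N mulmxDl -mulmxA ru mulmx0 addr0.
Qed.
End Count.

(** * Undamped modes and the spectrum of the effective Laplacian *)

Section Modes.
Variables (R : realType) (n q : nat).
Variables (A : 'M[R]_(n, q)) (G B : 'M[R]_n).

(* An undamped nonsynchronous normal mode, at angular frequency
   [sqrt (w0 ^+ 2 + mu)]. *)
Definition undamped_mode (f : 'cV[R[i]]_n) (mu : R) : Prop :=
  [/\ toC G *m f = 0, toC B *m f = mu%:C%C *: (toC (A *m A^T) *m f),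
      (const_mx 1 : 'rV_q) *m toC A^T *m f = 0 & toC A^T *m f <> 0].

Lemma nb_imaginary_eigenvalues_modes (p : 'cV[R]_n) : (0 < q)%N ->
    psd G -> psd B -> \rank A = q ->
    G *m p = 0 -> B *m p = 0 -> A^T *m p = const_mx 1 ->
  nb_imaginary_eigenvalues (effective_laplacian A G B) = 1%N <->
  ~ exists f mu, undamped_mode f mu.
Proof.
move=> q0 Gp Bp Ar Gp0 Bp0 Ap.
set Y := effective_laplacian A G B.
have YP := effective_laplacianP Gp Bp Ar.
rewrite (@nb_imaginary_eigenvalues_eq1 _ _ _ (const_mx 1)); last 2 first.
- exact: effective_laplacian_sum0 Gp0 Bp0 Ap.
- rewrite mxE (eq_bigr (fun=> 1)) => [|k _]; last by rewrite !mxE mulr1.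
  by rewrite sumr_const card_ord raddfMn/= pmulrn_lgt0// ltr01.
split=> [Yspec [f [mu [Gf Bf sf Af]]]|Nmode u z z0 su Yu].
  (* A mode [f] makes [A^T f] an eigenvector of [Y] for [j mu]. *)
  apply: Af; apply: (Yspec _ ('i%C * mu%:C%C)).
  - by rewrite complex_ReM /= mul0r mulr0 subr0.
  - by rewrite mulmxA.
  - apply/YP; exists f; rewrite toCT; split=> //.
    rewrite mulmxDl Gf add0r -scalemxAl Bf toCM -mulmxA scalerA toCT.
    by rewrite -scalemxAr.
apply: contrapT => u0; apply: Nmode.
have [f [Af Lf]] := (YP _ _).1 Yu.
have zE : z = 'i%C * (complex.Im z)%:C%C.
  by rewrite [LHS]complexE z0 add0r.
set m := complex.Im z in zE.
have [g0 gE] := Gp.2 f; have [b0 _] := Bp.2 f.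
have [a0 _] := (psd_gram A).2 f.
have AAf : toC A *m (z *: u) = z *: (toC (A *m A^T) *m f).
  by rewrite -scalemxAr -Af toCM toCT mulmxA.
have Gf : toC G *m f = 0.
  apply: gE.
  have : qform G f + 'i%C * qform B f = z * qform (A *m A^T) f.
    rewrite -admittance_formE -mulmxA Lf AAf -scalemxAr mxZE.
    by rewrite /qform mulmxA.
  by rewrite zE => /(add_imaginary_inj g0 b0 a0)[].
exists f, m; split=> //.
- have i0 : 'i%C != 0 :> R[i] by rewrite eq_complex /= oner_eq0 andbF.
  apply: (scalerI i0); rewrite scalerA -zE -AAf -Lf mulmxDl Gf add0r.
  by rewrite -scalemxAl.
- by rewrite toCT -mulmxA Af.
- by rewrite toCT Af.
Qed.
End Modes.

(** * Decay of voltage differences *)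

Section PsdKernel.
Variable R : realType.

Lemma psdD_ker n m (S T : 'M[R]_n) (F : 'M[R[i]]_(n, m)) : psd S -> psd T ->
  toC (S + T) *m F = 0 -> toC S *m F = 0 /\ toC T *m F = 0.
Proof.
move=> [_ Sp] [_ Tp] STF.
suff colST j : toC S *m col j F = 0 /\ toC T *m col j F = 0.
  by split; apply/matrixP => i j;
    have [/colP/(_ i) S0 /colP/(_ i) T0] := colST j;
    [move: S0 | move: T0]; rewrite colE mulmxA -colE !mxE.
have STf : toC (S + T) *m col j F = 0 by rewrite colE mulmxA STF mul0mx.
have := qformD S T (col j F).
have [[S0 SE] [T0 TE]] := (Sp (col j F), Tp (col j F)).
rewrite {1}/qform -mulmxA STf mulmx0 mxE => /esym/eqP.
by rewrite (paddr_eq0 S0 T0) => /andP[/eqP/SE -> /eqP/TE ->].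
Qed.

Lemma psdD_ker_real n m (S T : 'M[R]_n) (F : 'M[R]_(n, m)) : psd S -> psd T ->
  (S + T) *m F = 0 -> S *m F = 0 /\ T *m F = 0.
Proof.
move=> Sp Tp STF.
have [] := @psdD_ker n m S T (toC F) Sp Tp; first by rewrite -toCM STF toC0.
by rewrite -!toCM -!(@toC0 R n m) => /toC_inj SF /toC_inj TF.
Qed.

Lemma gram_ker n m k (D : 'M[R]_(n, m)) (F : 'M[R[i]]_(n, k)) :
  toC (D *m D^T) *m F = 0 -> toC D^T *m F = 0.
Proof.
move=> DF; apply/matrixP => i j.
have /qform_gram_eq0/colP/(_ i) : qform (D *m D^T) (col j F) = 0.
  have DFj : toC (D *m D^T) *m col j F = 0 by rewrite colE mulmxA DF mul0mx.
  by rewrite /qform -mulmxA DFj mulmx0 mxE.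
by rewrite colE mulmxA -colE !mxE.
Qed.

Lemma gram_ker_real n m k (D : 'M[R]_(n, m)) (F : 'M[R]_(n, k)) :
  D *m D^T *m F = 0 -> D^T *m F = 0.
Proof.
move=> DF; apply: (@toC_inj R); rewrite toCM toC0.
by apply: gram_ker; rewrite -toCM DF toC0.
Qed.
End PsdKernel.

Lemma voltageE (R : realType) n q (A : 'M[R]_(n, q)) e k t :
  voltage A e k t = (A^T *m e t) k 0.
Proof. by []. Qed.

Lemma derivable_mx_derive (R : realType) n (e : R -> 'cV[R]_n) t :
  derivable e t 1 -> mx_derive e t (e^`()%classic t).
Proof.
move=> ed i; apply: DeriveDef; first exact: (derivable_mxP _ _ _).1.
by rewrite derive1E derive_mx// mxE.
Qed.

Lemma dotmx_lincomb (F : comPzRingType) n (w : 'rV[F]_n) (a b c d : 'cV[F]_n)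
    (x y z : F) :
  (w *m (x *: a + y *: b + (c + z *: d))) 0 0 =
  x * (w *m a) 0 0 + y * (w *m b) 0 0 + ((w *m c) 0 0 + z * (w *m d) 0 0).
Proof. by rewrite !mulmxDr -!scalemxAr !mxDE !mxZE. Qed.

(** Energy identity of a mode growing or persisting like [expR (Re z * t)]: after multiplication by
    the conjugate of [z], the real part is a sum of nonnegative terms. Here [a], [g], [b] stand for
    the inertial, damping and stiffness forms, and [c] for [w0 ^+ 2]. *)
Lemma dissipative_quadratic (R : realType) (z : R[i]) (a g b c : R) :
    z != 0 -> 0 <= complex.Re z -> 0 <= a -> 0 <= g -> 0 <= b -> 0 <= c ->
    z ^+ 2 * a%:C%C + z * g%:C%C + (b%:C%C + c%:C%C * a%:C%C) = 0 ->
  g = 0 /\ ((a = 0 /\ b = 0) \/ complex.Re z = 0).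
Proof.
case: z => x y /=; rewrite expr2 => z0 x0 a0 g0 b0 c0 /eqP.
rewrite eq_complex /= !(mul0r, mulr0, subr0, addr0, add0r).
move=> /andP[/eqP re0 /eqP im0].
have z2 : 0 < x ^+ 2 + y ^+ 2.
  rewrite lt_neqAle addr_ge0 ?sqr_ge0// andbT eq_sym.
  rewrite paddr_eq0 ?sqr_ge0// !sqrf_eq0.
  by move: z0; rewrite eq_complex.
(* The real part of [z^*] times the hypothesis. *)
have sum0 : x * (x ^+ 2 + y ^+ 2 + c) * a + (x ^+ 2 + y ^+ 2) * g + x * b = 0.
  have := congr1 ( *%R x) re0; have := congr1 ( *%R y) im0.
  by rewrite !mulr0; lra.
have xa : 0 <= x * (x ^+ 2 + y ^+ 2 + c) * a.
  by rewrite !mulr_ge0// addr_ge0// ltW.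
have zg : 0 <= (x ^+ 2 + y ^+ 2) * g by rewrite mulr_ge0// ltW.
have xb : 0 <= x * b by rewrite mulr_ge0.
split.
  by apply: (mulfI (lt0r_neq0 z2)); rewrite mulr0; lra.
have [->|xn0] := eqVneq x 0; [by right | left].
have xp : 0 < x by rewrite lt_neqAle eq_sym xn0.
have z2c : x * (x ^+ 2 + y ^+ 2 + c) != 0.
  by rewrite mulf_neq0// gt_eqF// ltr_wpDr.
split; first by apply: (mulfI z2c); rewrite mulr0; lra.
by apply: (mulfI xn0); rewrite mulr0; lra.
Qed.

Section Damped.
Variables (R : realType) (n q : nat).
Variables (A : 'M[R]_(n, q)) (G B : 'M[R]_n) (w0 : R) (p : 'cV[R]_n).
Hypotheses (q_gt0 : (0 < q)%N) (w0_gt0 : 0 < w0).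
Hypotheses (Gpsd : psd G) (Bpsd : psd B).
Hypotheses (Gp : G *m p = 0) (Bp : B *m p = 0) (Ap : A^T *m p = const_mx 1).

(* [P] projects along the common kernel of [M], [G], [B], on which [e] is
   arbitrary; [O] removes the in-phase oscillation, i.e. the mean of the
   voltages.  The projected solution [P O e] also solves the equation whose
   damping [G'] has the extra terms [s^T s] and [Z], as both vanish on it; they
   make the new pencil regular and free of the modes removed. *)
Let M := A *m A^T.
Let T := M + G + B.
Let P := pinvmx T *m T.
Let Z := (1%:M - P)^T *m (1%:M - P).
Let s := (const_mx 1 : 'rV[R]_q) *m A^T.
Let O := 1%:M - (q%:R)^-1 *: (p *m s).
Let G' := G + (s^T *m s + Z).
Let Q := B + w0 ^+ 2 *: M.

Let Mpsd : psd M. Proof. exact: psd_gram. Qed.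

Let TP : T *m P = T.
Proof. by rewrite /P mulmxA mulmxKpV. Qed.

Let PP : P *m P = P.
Proof. by rewrite {1}/P -mulmxA TP. Qed.

(** [T] annihilates [P - 1], hence so does each of its positive semidefinite summands. *)
Let kerP : [/\ M *m P = M, G *m P = G, B *m P = B & A^T *m P = A^T].
Proof.
have : T *m (P - 1%:M) = 0 by rewrite mulmxBr TP mulmx1 subrr.
move=> /(psdD_ker_real (psdD Mpsd Gpsd) Bpsd)[+ BP0].
move=> /(psdD_ker_real Mpsd Gpsd)[MP0 GP0].
have AP0 := gram_ker_real MP0.
by split; apply/eqP; rewrite -subr_eq0 -[X in _ - X]mulmx1 -mulmxBr;
  [rewrite MP0 | rewrite GP0 | rewrite BP0 | rewrite AP0].
Qed.

Let sE : s = p^T *m M.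
Proof.
rewrite /M mulmxA; congr (_ *m _); apply: trmx_inj.
rewrite trmx_mul trmxK Ap.
by apply/matrixP => i j; rewrite !mxE.
Qed.

Let sp : s *m p = (q%:R)%:M.
Proof.
rewrite /s -mulmxA Ap [LHS]mx11_scalar mxE (eq_bigr (fun=> 1)) => [|k _].
  by rewrite sumr_const card_ord.
by rewrite !mxE mulr1.
Qed.

Let sO : s *m O = 0.
Proof.
rewrite mulmxBr mulmx1 -scalemxAr mulmxA sp mul_scalar_mx scalerA.
by rewrite mulVf ?scale1r ?subrr// pnatr_eq0 -lt0n.
Qed.

(** The first three equations give [T f = 0], so [P f = 0]; the last one says [f = P f]. *)
Let joint_ker (f : 'cV[R[i]]_n) : toC M *m f = 0 -> toC G *m f = 0 ->
  toC B *m f = 0 -> toC (1%:M - P) *m f = 0 -> f = 0.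
Proof.
move=> Mf Gf Bf; rewrite toCB toC1 mulmxBl mul1mx /P toCM -mulmxA.
by rewrite /T !toCD !mulmxDl Mf Gf Bf !addr0 mulmx0 subr0.
Qed.

Let G'psd : psd (s^T *m s + Z).
Proof.
apply: psdD; first by have := psd_gram s^T; rewrite trmxK.
by have := psd_gram (1%:M - P)^T; rewrite trmxK.
Qed.

Let G'_ker (f : 'cV[R[i]]_n) : toC G' *m f = 0 ->
  [/\ toC G *m f = 0, toC s *m f = 0 & toC (1%:M - P) *m f = 0].
Proof.
have spsd : psd (s^T *m s) by have := psd_gram s^T; rewrite trmxK.
have Zpsd : psd Z by have := psd_gram (1%:M - P)^T; rewrite trmxK.
move=> /(psdD_ker Gpsd G'psd)[Gf /(psdD_ker spsd Zpsd)[sf Zf]].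
split=> //.
  by have := @gram_ker _ _ _ _ s^T f; rewrite trmxK; apply.
by have := @gram_ker _ _ _ _ (1%:M - P)^T f; rewrite trmxK; apply.
Qed.

Let Qpsd : psd (w0 ^+ 2 *: M).
Proof.
suff -> : w0 ^+ 2 *: M = (w0 *: A) *m (w0 *: A)^T by exact: psd_gram.
by rewrite linearZ/= -scalemxAl -scalemxAr scalerA.
Qed.

Let Q_ker (f : 'cV[R[i]]_n) : toC Q *m f = 0 ->
  toC M *m f = 0 /\ toC B *m f = 0.
Proof.
move=> /(psdD_ker Bpsd Qpsd)[Bf w0Mf]; split=> //; apply/eqP.
have : (w0 ^+ 2)%:C%C *: (toC M *m f) == 0.
  by rewrite scalemxAl -w0Mf; apply/eqP; congr (_ *m _); rewrite /toC map_mxZ.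
by rewrite scaler_eq0 eq_complex /= sqrf_eq0 gt_eqF.
Qed.

(** Inclusion of row spaces is reverse inclusion of kernels: [Q] has positive semidefinite summands,
    so its kernel lies in that of [M], which is that of [A^T]. *)
Let A_Q : (A^T <= Q)%MS.
Proof.
rewrite submxE; apply/eqP.
have /(psdD_ker_real Bpsd Qpsd)[_] : Q *m cokermx Q = 0 by exact: mulmx_coker.
rewrite -scalemxAl => /eqP; rewrite scaler_eq0 sqrf_eq0 gt_eqF//= => /eqP.
exact: gram_ker_real.
Qed.

Hypothesis no_mode : ~ exists f mu, undamped_mode A G B f mu.

(** By [dissipative_quadratic], [G' f = 0], and either [M f = B f = 0], so that [joint_ker]
    concludes, or [z] is imaginary and [f] would be an undamped mode unless [A^T f = 0]. *)
Let damped_spec z (f : 'cV[R[i]]_n) : z != 0 -> 0 <= complex.Re z ->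
  z ^+ 2 *: (toC M *m f) + z *: (toC G' *m f) + toC Q *m f = 0 -> f = 0.
Proof.
move=> z0 rez damped.
have [[[a0 aE] [g0 gE]] [b0 bE]] := (Mpsd.2 f, (psdD Gpsd G'psd).2 f, Bpsd.2 f).
have fin : toC G' *m f = 0 -> toC M *m f = 0 -> toC B *m f = 0 -> f = 0.
  by move=> /G'_ker[Gf _ Pf] Mf Bf; exact: (joint_ker Mf Gf Bf Pf).
have QE : toC Q *m f = toC B *m f + (w0 ^+ 2)%:C%C *: (toC M *m f).
  rewrite /Q toCD mulmxDl scalemxAl; congr (_ + _ *m _).
  by rewrite /toC map_mxZ.
have : z ^+ 2 * qform M f + z * qform G' f
    + (qform B f + (w0 ^+ 2)%:C%C * qform M f) = 0.
  have qE S : (f^t* *m (toC S *m f)) 0 0 = qform S f by rewrite mulmxA.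
  by rewrite -!qE -dotmx_lincomb -QE damped mulmx0 mxE.
have [aC ar0] := ge0_complexE a0; have [gC gr0] := ge0_complexE g0.
have [bC br0] := ge0_complexE b0; rewrite aC gC bC.
move=> /(dissipative_quadratic z0 rez ar0 gr0 br0 (sqr_ge0 w0))[gr xab].
have G'f : toC G' *m f = 0 by apply: gE; rewrite gC gr.
have [[ar br]|x0] := xab.
  by apply: (fin G'f); [apply: aE; rewrite aC ar | apply: bE; rewrite bC br].
have [Gf sf _] := G'_ker G'f.
(* The angular frequency [Im z] of a mode has square [w0 ^+ 2 + mu]. *)
pose mu := complex.Im z ^+ 2 - w0 ^+ 2.
have z2 : z ^+ 2 = - (complex.Im z ^+ 2)%:C%C.
  by rewrite [in LHS](complexE z) x0 add0r exprMn sqr_i mulN1r rmorphXn.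
have Bf : toC B *m f = mu%:C%C *: (toC M *m f).
  apply/eqP; rewrite -subr_eq0; apply/eqP; rewrite -[RHS]damped G'f QE z2.
  rewrite scaler0 addr0 addrCA rmorphB/= scalerBl opprB scaleNr.
  by rewrite [- _ + _]addrC.
have Af : toC A^T *m f = 0.
  apply: contrapT => Af; apply: no_mode; exists f, mu; split=> //.
  rewrite -[RHS]sf /s toCM; congr (_ *m _ *m _).
  by apply/matrixP => i j; rewrite !mxE.
have Mf : toC M *m f = 0 by rewrite /M toCM -mulmxA Af mulmx0.
by apply: fin => //; rewrite Bf Mf scaler0.
Qed.

(** [M], [G] and [B] absorb [P], while [G] and [B] absorb [O]. In the terms with [M], [O] subtracts
    a multiple of [M p] whose coefficient vanishes by [s_osc]. *)
Let damped_eqn (x0 x1 x2 : 'cV[R]_n) :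
  M *m (x2 + w0 ^+ 2 *: x0) + G *m x1 + B *m x0 = 0 ->
  M *m (P *m (O *m x2)) + G' *m (P *m (O *m x1)) + Q *m (P *m (O *m x0)) = 0.
Proof.
move=> solt.
have [MP GP BP AP] := kerP.
have MPx x : M *m (P *m x) = M *m x by rewrite mulmxA MP.
have GPx x : G *m (P *m x) = G *m x by rewrite mulmxA GP.
have BPx x : B *m (P *m x) = B *m x by rewrite mulmxA BP.
have sPO x : s *m (P *m (O *m x)) = 0.
  have sP : s *m P = s by rewrite /s -mulmxA AP.
  by rewrite mulmxA sP mulmxA sO mul0mx.
have ZP x : Z *m (P *m x) = 0.
  have PP0 : (1%:M - P) *m P = 0 by rewrite mulmxBl mul1mx PP subrr.
  by rewrite /Z -mulmxA [_ *m (P *m x)]mulmxA PP0 mul0mx mulmx0.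
have GO x : G *m (O *m x) = G *m x.
  rewrite mulmxA /O mulmxBr mulmx1 -scalemxAr mulmxA Gp mul0mx.
  by rewrite scaler0 subr0.
have BO x : B *m (O *m x) = B *m x.
  rewrite mulmxA /O mulmxBr mulmx1 -scalemxAr mulmxA Bp mul0mx.
  by rewrite scaler0 subr0.
have MO x : M *m (O *m x) = M *m x - q%:R^-1 *: (M *m p *m (s *m x)).
  rewrite [LHS]mulmxA /O mulmxBr mulmx1 mulmxBl -scalemxAr -scalemxAl.
  by rewrite !mulmxA.
have G'x x : G' *m x = G *m x + (s^T *m (s *m x) + Z *m x).
  by rewrite mulmxA -!mulmxDl.
have Qx x : Q *m x = B *m x + w0 ^+ 2 *: (M *m x).
  by rewrite scalemxAl -mulmxDl.
rewrite G'x Qx sPO mulmx0 ZP !addr0 !MPx GPx BPx GO BO !MO.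
move: solt; rewrite -/M mulmxDr -scalemxAr => solt.
(* Multiplying by [p^T], which [G] and [B] annihilate, shows that the sum of the voltages is a free
   harmonic oscillation. *)
have s_osc : s *m x2 + w0 ^+ 2 *: (s *m x0) = 0.
  have := congr1 (mulmx p^T) solt.
  have pG : p^T *m G = 0 by rewrite -Gpsd.1 -trmx_mul Gp trmx0.
  have pB : p^T *m B = 0 by rewrite -Bpsd.1 -trmx_mul Bp trmx0.
  rewrite !mulmxDr mulmx0 -scalemxAr 4!mulmxA pG pB !mul0mx !addr0.
  by rewrite -sE.
have := congr1 (fun x => q%:R^-1 *: (M *m p *m x)) s_osc.
rewrite /= mulmx0 scaler0 mulmxDr -scalemxAr => Ms_osc.
rewrite -[RHS](subrr 0) -[X in _ = X - _]solt -[X in _ = _ - X]Ms_osc.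
move: (M *m x2) (M *m x0) (G *m x1) (B *m x0) (M *m p *m (s *m x2))
  (M *m p *m (s *m x0)) => a b c d f g.
by apply/matrixP => i j; rewrite !mxE; ring.
Qed.

(** The voltages of [P O e] are the deviations of those of [e] from their mean. They decay by
    [second_order_tends0], and the mean cancels in a difference. *)
Lemma no_mode_voltages (e : R -> 'cV[R]_n) (k l : 'I_q) :
    network_solution A G B w0 e ->
  voltage A e k t - voltage A e l t @[t --> +oo] --> (0 : R).
Proof.
move=> esol.
have ed (t : R) : 0 <= t -> mx_derive e t (e^`()%classic t).
  by move=> /esol[/derivable_mx_derive].
have e1d (t : R) : 0 <= t -> mx_derive (e^`()%classic) t (e^`(2)%classic t).
  by move=> /esol[_ /derivable_mx_derive].
have sol0 := fun t t0 => let: And3 _ _ E := esol t t0 in E.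
have v0 : forall i, (A^T *m (P *m (O *m e t))) i 0 @[t --> +oo] --> (0 : R).
  apply: (@second_order_tends0 R n q M G' Q A^T (fun t => P *m (O *m e t))
    (fun t => P *m (O *m e^`()%classic t))
    (fun t => P *m (O *m e^`(2)%classic t))).
  - by move=> t /ltW t0; exact: (mx_deriveM P (mx_deriveM O (ed t t0))).
  - by move=> t /ltW t0; exact: (mx_deriveM P (mx_deriveM O (e1d t t0))).
  - move=> t /ltW/sol0 solt.
    by have := damped_eqn solt.
  - by rewrite /Q linearD linearZ/= Bpsd.1 Mpsd.1.
  - exact: A_Q.
  - by move=> z f; exact: damped_spec.
  - move=> f /Q_ker[Mf Bf] Gf.
    have /G'_ker[Gf0 _ Pf] : toC G' *m f = 0.
      by apply: ((psdD Gpsd G'psd).2 f).2; rewrite /qform Gf mxE.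
    exact: (joint_ker Mf Gf0 Bf Pf).
have vE t i : (A^T *m (P *m (O *m e t))) i 0 =
    voltage A e i t - (q%:R^-1 *: (s *m e t)) 0 0.
  have [_ _ _ AP] := kerP.
  rewrite mulmxA AP mulmxA /O mulmxBr mulmx1 -scalemxAr mulmxA Ap mulmxBl.
  rewrite mxBE -scalemxAl !mxZE; congr (_ - _ * _).
  by rewrite -mulmxA mxE big_ord1 mxE mul1r.
have -> : (fun t => voltage A e k t - voltage A e l t) =
    (fun t => 1 * (A^T *m (P *m (O *m e t))) k 0
              + (-1) * (A^T *m (P *m (O *m e t))) l 0).
  by apply/funext => t; rewrite !vE; ring.
exact: tends0_lincomb.
Qed.
End Damped.

(** * Oscillating solutions *)

Section Oscillation.
Variable R : realType.

Definition osc (b : bool) (w t : R) : R :=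
  if b then cos (w * t) else sin (w * t).

Definition dosc (b : bool) (w t : R) : R :=
  if b then - w * sin (w * t) else w * cos (w * t).

Lemma is_derive_cosM (w t : R) :
  is_derive t 1 (fun s => cos (w * s)) (- w * sin (w * t)).
Proof.
have -> : - w * sin (w * t) = - sin (w * t) * w by ring.
by apply: is_derive1_comp; apply: is_derive_eq; rewrite scaler1.
Qed.

Lemma is_derive_sinM (w t : R) :
  is_derive t 1 (fun s => sin (w * s)) (w * cos (w * t)).
Proof.
rewrite mulrC.
by apply: is_derive1_comp; apply: is_derive_eq; rewrite scaler1.
Qed.

Lemma is_derive_osc b (w t : R) : is_derive t 1 (osc b w) (dosc b w t).
Proof. by case: b; [exact: is_derive_cosM | exact: is_derive_sinM]. Qed.

Lemma is_derive_dosc b (w t : R) :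
  is_derive t 1 (dosc b w) (- w ^+ 2 * osc b w t).
Proof.
case: b; rewrite /dosc /osc.
  have := is_deriveZ (- w) (is_derive_sinM w t).
  by rewrite [_ *: _]mulrA expr2 mulNr; apply.
have := is_deriveZ w (is_derive_cosM w t).
by rewrite [_ *: _]mulrA mulrN expr2; apply.
Qed.

Lemma osc_sqr_sum (w t : R) : osc true w t ^+ 2 + osc false w t ^+ 2 = 1.
Proof. exact: cos2Dsin2. Qed.

Lemma osc_le1 b (w t : R) : `|osc b w t| <= 1.
Proof.
by case: b; rewrite /osc ler_norml ?cos_geN1 ?cos_le1 ?sin_geN1 ?sin_le1.
Qed.

Lemma is_derive_mx n (e : R -> 'cV[R]_n) (t : R) de :
  mx_derive e t de -> is_derive t 1 e de.
Proof.
move=> ed; have edd : derivable e t 1.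
  by apply/derivable_mxP => i j; rewrite ord1; have [] := ed i.
apply: DeriveDef => //; rewrite derive_mx//; apply/colP => i.
by rewrite mxE; have [_ ->] := ed i.
Qed.

Lemma is_derive_lincomb n (c1 c2 : R -> R) (t d1 d2 : R) (x y : 'cV[R]_n) :
  is_derive t 1 c1 d1 -> is_derive t 1 c2 d2 ->
  is_derive t 1 (fun s => c1 s *: x + c2 s *: y) (d1 *: x + d2 *: y).
Proof.
move=> c1d c2d; apply: is_derive_mx => i; rewrite !mxE.
have -> : (fun s => (c1 s *: x + c2 s *: y) i 0) =
    (fun s => x i 0 *: c1 s + y i 0 *: c2 s).
  by apply/funext => s; rewrite !mxE mulrC [X in _ + X]mulrC.
rewrite mulrC [X in _ + X]mulrC.
exact: (is_deriveD (is_deriveZ (x i 0) c1d) (is_deriveZ (y i 0) c2d)).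
Qed.
End Oscillation.

Section Mode.
Variables (R : realType) (n q : nat).
Variables (A : 'M[R]_(n, q)) (G B : 'M[R]_n) (w0 : R).
Implicit Types p x : 'cV[R]_n.

(** Along [p] there is neither damping nor coupling, so it oscillates at [w0]; along [x] the
    coupling acts as extra stiffness [mu]. *)
Lemma mode_solution p x (a mu w : R) b1 b2 :
    G *m p = 0 -> B *m p = 0 -> G *m x = 0 -> B *m x = mu *: (A *m A^T *m x) ->
    w ^+ 2 = w0 ^+ 2 + mu ->
  network_solution A G B w0 (fun t => (a * osc b1 w0 t) *: p + osc b2 w t *: x).
Proof.
move=> Gp Bp Gx Bx w2.
set e : R -> 'cV[R]_n := fun t : R => _.
pose e1 (t : R) : 'cV[R]_n := (a * dosc b1 w0 t) *: p + dosc b2 w t *: x.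
pose e2 (t : R) : 'cV[R]_n :=
  (a * (- w0 ^+ 2 * osc b1 w0 t)) *: p + (- w ^+ 2 * osc b2 w t) *: x.
have ed (t : R) : is_derive t 1 e (e1 t).
  apply: is_derive_lincomb; last exact: is_derive_osc.
  exact: is_deriveZ (is_derive_osc b1 w0 t).
have e1d (t : R) : is_derive t 1 e1 (e2 t).
  apply: is_derive_lincomb; last exact: is_derive_dosc.
  exact: is_deriveZ (is_derive_dosc b1 w0 t).
have eE : e^`()%classic = e1 by apply/funext => t; rewrite derive1E derive_val.
have e1E : e^`(2)%classic = e2.
  rewrite derive1nS derive1n1 eE; apply/funext => t.
  by rewrite derive1E derive_val.
move=> t _; rewrite e1E eE; split; [by have [] := ed t|by have [] := e1d t|].
have -> : e2 t + w0 ^+ 2 *: e t = - mu *: (osc b2 w t *: x).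
  rewrite /e2 /e scalerDr !scalerA addrACA -!scalerDl w2.
  rewrite (_ : _ + _ = 0 :> R) ?scale0r ?add0r; last by ring.
  by congr (_ *: _); rewrite /GRing.scale/=; ring.
rewrite /e1 /e !mulmxDr -!scalemxAr Gp Gx Bp Bx !scaler0 !addr0 add0r.
by rewrite !scalerA addrC -scalerDl (_ : _ + _ = 0 :> R) ?scale0r//; ring.
Qed.
End Mode.

Lemma norm_diff_tends0 (R : realType) (a b : R -> R) :
    a t - b t @[t --> +oo] --> (0 : R) ->
  `|a t| - `|b t| @[t --> +oo] --> (0 : R).
Proof.
move=> ab; apply: tends0_sqr.
apply: (tends0_le (g := fun t => (a t - b t) * (a t - b t)));
  last exact: tends0M.
move=> t; rewrite sqr_ge0/= -expr2 -[leRHS]real_normK ?num_real//.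
rewrite -[leLHS]real_normK ?num_real// ler_pXn2r ?nnegrE//.
exact: ler_dist_dist.
Qed.

(** The difference of squares factors through [|a| + |b|], which is at most [2 * c]. *)
Lemma sqr_diff_tends0 (R : realType) (a b : R -> R) (c : R) :
    (forall t, `|a t| <= c) -> (forall t, `|b t| <= c) ->
    `|a t| - `|b t| @[t --> +oo] --> (0 : R) ->
  a t ^+ 2 - b t ^+ 2 @[t --> +oo] --> (0 : R).
Proof.
move=> ac bc ab; apply: tends0_sqr.
pose d t := `|a t| - `|b t|.
apply: (tends0_le (g := fun t => (2 * c) ^+ 2 * (d t * d t) + 0 * d t)).
  move=> t; rewrite sqr_ge0/= mul0r addr0 -[a t ^+ 2]real_normK ?num_real//.
  rewrite -[b t ^+ 2]real_normK ?num_real// subr_sqr exprMn mulrC -expr2.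
  rewrite ler_wpM2r ?sqr_ge0// ler_pXn2r ?nnegrE ?addr_ge0//.
    by rewrite mulr2n mulrDl mul1r lerD.
  by rewrite mulr_ge0// (le_trans _ (ac t)).
by apply: tends0_lincomb => //; exact: tends0M.
Qed.

(** * Synchrony and undamped modes *)

Section RealMode.
Variable R : realType.

Lemma Re_toCM m n p (S : 'M[R]_(m, n)) (F : 'M[R[i]]_(n, p)) :
  map_mx (@complex.Re R) (toC S *m F) = S *m map_mx (@complex.Re R) F.
Proof.
apply/matrixP => i j; rewrite !mxE raddf_sum; apply: eq_bigr => k _.
by rewrite !mxE; case: (F k j) => a b /=; rewrite mul0r subr0.
Qed.

Lemma Im_toCM m n p (S : 'M[R]_(m, n)) (F : 'M[R[i]]_(n, p)) :
  map_mx (@complex.Im R) (toC S *m F) = S *m map_mx (@complex.Im R) F.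
Proof.
apply/matrixP => i j; rewrite !mxE raddf_sum; apply: eq_bigr => k _.
by rewrite !mxE; case: (F k j) => a b /=; rewrite mul0r addr0.
Qed.

(** All coefficients are real, so the real and imaginary parts of [f] both satisfy the equations,
    and [A^T] cannot annihilate both. *)
Lemma real_mode n q (A : 'M[R]_(n, q)) (G B : 'M[R]_n) f mu :
    undamped_mode A G B f mu ->
  exists x : 'cV[R]_n,
    [/\ G *m x = 0, B *m x = mu *: (A *m A^T *m x),
        (const_mx 1 : 'rV_q) *m (A^T *m x) = 0 & A^T *m x <> 0].
Proof.
move=> [Gf Bf sf Af].
have one : (const_mx 1 : 'rV[R[i]]_q) = toC (const_mx 1).
  by apply/matrixP => i j; rewrite !mxE.
have ReZ m (F : 'cV[R[i]]_m) :
    map_mx (@complex.Re R) (mu%:C%C *: F) = mu *: map_mx (@complex.Re R) F.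
  apply/colP => i; rewrite !mxE; case: (F i 0) => a b /=.
  by rewrite mul0r subr0.
have ImZ m (F : 'cV[R[i]]_m) :
    map_mx (@complex.Im R) (mu%:C%C *: F) = mu *: map_mx (@complex.Im R) F.
  apply/colP => i; rewrite !mxE; case: (F i 0) => a b /=.
  by rewrite mul0r addr0.
have Re0 m k : map_mx (@complex.Re R) (0 : 'M[R[i]]_(m, k)) = 0.
  by rewrite raddf0.
have Im0 m k : map_mx (@complex.Im R) (0 : 'M[R[i]]_(m, k)) = 0.
  by rewrite raddf0.
rewrite one -mulmxA in sf.
have [Are|] := pselect (A^T *m map_mx (@complex.Re R) f = 0); last first.
  exists (map_mx (@complex.Re R) f); split=> //.
  - by rewrite -Re_toCM Gf Re0.
  - by rewrite -!Re_toCM Bf ReZ.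
  - by rewrite -!Re_toCM sf Re0.
exists (map_mx (@complex.Im R) f); split=> [|||Aim].
- by rewrite -Im_toCM Gf Im0.
- by rewrite -!Im_toCM Bf ImZ.
- by rewrite -!Im_toCM sf Im0.
apply: Af; apply/colP => i; rewrite [RHS]mxE; apply/eqP; rewrite eq_complex.
rewrite -Re_toCM in Are; rewrite -Im_toCM in Aim.
move/colP/(_ i) : Are; rewrite mxE [RHS]mxE => ->.
by move/colP/(_ i) : Aim; rewrite mxE [RHS]mxE => ->; rewrite !eqxx.
Qed.

(** [mu] is a quotient of two nonnegative forms at [x]. Its sign makes the frequency of the mode
    real. *)
Lemma mode_stiffness_ge0 n q (A : 'M[R]_(n, q)) (B : 'M[R]_n)
    (x : 'cV[R]_n) mu :
    psd B -> B *m x = mu *: (A *m A^T *m x) -> A^T *m x <> 0 -> 0 <= mu.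
Proof.
move=> Bp Bx Ax.
have [b0 _] := Bp.2 (toC x).
have [a0 aE] := (psd_gram A).2 (toC x).
have ba : qform B (toC x) = mu%:C%C * qform (A *m A^T) (toC x).
  have BxC : toC B *m toC x = mu%:C%C *: (toC (A *m A^T) *m toC x).
    by rewrite -!toCM Bx /toC map_mxZ.
  by rewrite /qform -!mulmxA BxC -scalemxAr mxZE.
have aN : qform (A *m A^T) (toC x) != 0.
  apply/eqP => a00; apply: Ax; apply: gram_ker_real; apply: (@toC_inj R).
  by rewrite toCM toC0 aE.
have ap : 0 < qform (A *m A^T) (toC x) by rewrite lt_neqAle eq_sym aN.
rewrite -ler0c -(pmulr_lge0 _ ap) -ba; exact: b0.
Qed.
End RealMode.

Section Synchrony.
Variables (R : realType) (n q : nat).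
Variables (A : 'M[R]_(n, q)) (G B : 'M[R]_n) (w0 : R) (p : 'cV[R]_n).
Hypotheses (q_gt0 : (0 < q)%N) (w0_gt0 : 0 < w0).
Hypotheses (Gpsd : psd G) (Bpsd : psd B).
Hypotheses (Gp : G *m p = 0) (Bp : B *m p = 0) (Ap : A^T *m p = const_mx 1).

Lemma synchronous_no_mode :
  synchronous A G B w0 -> ~ exists f mu, undamped_mode A G B f mu.
Proof.
move=> [sync _] [f [mu /real_mode[x [Gx Bx sx Ax]]]].
have mu0 := mode_stiffness_ge0 Bpsd Bx Ax.
pose w := Num.sqrt (w0 ^+ 2 + mu).
have w2 : w ^+ 2 = w0 ^+ 2 + mu by rewrite sqr_sqrtr// addr_ge0// sqr_ge0.
pose u k := (A^T *m x) k 0.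
pose v a b1 b2 k t := a * osc b1 w0 t + osc b2 w t * u k.
pose e a b1 b2 t : 'cV[R]_n := (a * osc b1 w0 t) *: p + osc b2 w t *: x.
have vE a b1 b2 k : voltage A (e a b1 b2) k = v a b1 b2 k.
  apply/funext => t; rewrite voltageE mulmxDr -!scalemxAr Ap.
  by rewrite mxDE !mxZE mxE mulr1.
(* Combining both signs [a] of the in-phase part and both phases of each
   oscillation eliminates time from [v_k ^ 2 - v_l ^ 2]. *)
have v_sqr a b1 b2 k l : `|a| <= 1 ->
    v a b1 b2 k t ^+ 2 - v a b1 b2 l t ^+ 2 @[t --> +oo] --> (0 : R).
  move=> a1; apply: (sqr_diff_tends0 (c := 1 + (`|u k| + `|u l|))).
  - move=> t; rewrite (le_trans (ler_normD _ _))// lerD//.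
      by rewrite normrM mulr_ile1// osc_le1.
    by rewrite normrM (@le_trans _ _ `|u k|) ?lerDl// ler_piMl// osc_le1.
  - move=> t; rewrite (le_trans (ler_normD _ _))// lerD//.
      by rewrite normrM mulr_ile1// osc_le1.
    by rewrite normrM (@le_trans _ _ `|u l|) ?lerDr// ler_piMl// osc_le1.
  - have := sync _ (mode_solution a b1 b2 Gp Bp Gx Bx w2) k l.
    by rewrite !vE.
(* Polarization: the values at [a = 1] and [a = -1] differ by four times this product. *)
have prod0 b1 b2 k l :
    osc b1 w0 t * osc b2 w t * (u k - u l) @[t --> +oo] --> (0 : R).
  have -> : (fun t => osc b1 w0 t * osc b2 w t * (u k - u l)) = (fun t =>
      4^-1 * (v 1 b1 b2 k t ^+ 2 - v 1 b1 b2 l t ^+ 2)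
      + (- 4^-1) * (v (-1) b1 b2 k t ^+ 2 - v (-1) b1 b2 l t ^+ 2)).
    by apply/funext => t; rewrite /v; field.
  by apply: tends0_lincomb; apply: v_sqr; rewrite ?normrN normr1.
have u_const k l : u k = u l.
  apply/eqP; rewrite -subr_eq0 -sqrf_eq0; apply/eqP.
  pose d b1 b2 t := osc b1 w0 t * osc b2 w t * (u k - u l).
  have dd b1 b2 : d b1 b2 t * d b1 b2 t @[t --> +oo] --> (0 : R).
    exact: (tends0M (prod0 b1 b2 k l) (prod0 b1 b2 k l)).
  have := tends0_lincomb 1 1
    (tends0_lincomb 1 1 (dd true true) (dd true false))
    (tends0_lincomb 1 1 (dd false true) (dd false false)).
  have -> : (fun t => 1 * (1 * (d true true t * d true true t)
        + 1 * (d true false t * d true false t))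
      + 1 * (1 * (d false true t * d false true t)
        + 1 * (d false false t * d false false t))) = cst ((u k - u l) ^+ 2).
    apply/funext => t; rewrite /d.
    transitivity ((osc true w0 t ^+ 2 + osc false w0 t ^+ 2) *
      (osc true w t ^+ 2 + osc false w t ^+ 2) * (u k - u l) ^+ 2);
      first by ring.
    by rewrite !osc_sqr_sum !mul1r.
  by move=> /(cvg_unique (@norm_hausdorff _ _) (cvg_cst _)) ->.
(* The entries of [A^T x] are equal and sum to 0, hence vanish. *)
apply: Ax; apply/colP => i.
rewrite [RHS]mxE -/(u i); move/matrixP/(_ 0 0) : sx; rewrite mxE.
rewrite (eq_bigr (fun=> u i)) => [|k _].
  rewrite sumr_const card_ord mxE => /eqP.
  by rewrite mulrn_eq0 -leqn0 leqNgt q_gt0 => /eqP.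
by rewrite mxE mul1r -/(u k).
Qed.

Lemma no_mode_synchronous :
  ~ (exists f mu, undamped_mode A G B f mu) -> synchronous A G B w0.
Proof.
move=> no_mode; split=> [e esol k l|].
  apply: norm_diff_tends0.
  exact: (no_mode_voltages q_gt0 w0_gt0 Gpsd Bpsd Gp Bp Ap no_mode).
pose k0 := Ordinal q_gt0.
apply: contrapT => trivial0.
(* For nontriviality the in-phase oscillation suffices: its cosine and sine versions cannot both
   decay, their squares adding up to 1. *)
have osc0 b : osc b w0 t @[t --> +oo] --> (0 : R).
  apply: contrapT => oscN; apply: trivial0.
  pose e t : 'cV[R]_n := (1 * osc b w0 t) *: p + osc b w0 t *: 0.
  have vE : voltage A e k0 = osc b w0.
    apply/funext => t; rewrite voltageE /e scaler0 addr0 mul1r -scalemxAr Ap.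
    by rewrite mxZE mxE mulr1.
  exists e; split; last by exists k0; rewrite vE.
  by apply: (@mode_solution _ _ _ _ _ _ _ _ _ _ 0);
    rewrite ?mulmx0 ?scaler0 ?addr0.
have := tends0_lincomb 1 1 (tends0M (osc0 true) (osc0 true))
  (tends0M (osc0 false) (osc0 false)).
have -> : (fun t => 1 * (osc true w0 t * osc true w0 t)
    + 1 * (osc false w0 t * osc false w0 t)) = cst 1.
  by apply/funext => t; rewrite !mul1r -!expr2 osc_sqr_sum.
by move=> /(cvg_unique (@norm_hausdorff _ _) (cvg_cst _))/eqP; rewrite oner_eq0.
Qed.
End Synchrony.

(** * Bilayer networks *)

Lemma class_F_sum1 (R : realType) m n (F : 'M[R]_(m, n)) :
  class_F F -> F^T *m const_mx 1 = const_mx 1 :> 'cV_n.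
Proof.
move=> [F01 F1 _]; apply/colP => j; rewrite !mxE.
rewrite -[RHS](congr1 (fun k => k%:R) (F1 j)) -sum1_card natr_sum.
rewrite [RHS]big_mkcond.
apply: eq_bigr => i _; rewrite !mxE mulr1 inE.
by have [->|->] := F01 i j; rewrite ?eqxx ?oner_eq0.
Qed.

Theorem theorem4 (R : realType) (n1 n2 q : nat)
  (A : 'M[R]_(n1 + n2, q)) (G B : 'M[R]_(n1 + n2)) (w0 : R)
  (G1 B1 : 'M[R]_n1) (G2 B2 : 'M[R]_n2)
  (F1 : 'M[R]_(n1, q)) (F2 : 'M[R]_(n2, q))
  (q_ge2 : (2 <= q)%N) (w0_gt0 : 0 < w0)
  (A_inc : oriented_incidence A)
  (A_par : no_parallel_oscillators A)
  (A_iso : no_isolated_node A)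
  (A_rank : \rank A = q)
  (G1_lap : laplacian G1) (B1_lap : laplacian B1)
  (G2_lap : laplacian G2) (B2_lap : laplacian B2)
  (F1_F : class_F F1) (F2_F : class_F F2)
  (G_def : G = block_mx G1 0 0 G2)
  (B_def : B = block_mx B1 0 0 B2)
  (A_def : A = col_mx F1 (- F2)) :
  synchronous A G B w0 <->
  nb_imaginary_eigenvalues (effective_laplacian A G B) = 1%N.
Proof.
have q_gt0 : (0 < q)%N by exact: ltnW.
(* The indicator of the first layer: no coupler joins the layers, so [G] and [B] annihilate it, and
   every oscillator goes from the first layer to the second, so it sees a unit voltage. *)
pose p : 'cV[R]_(n1 + n2) := col_mx (const_mx 1) 0.
have Gpsd : psd G by rewrite G_def; apply: psd_block; exact: psd_laplacian.
have Bpsd : psd B by rewrite B_def; apply: psd_block; exact: psd_laplacian.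
have Gp : G *m p = 0.
  rewrite G_def mul_block_col laplacian_const//.
  by rewrite !(mulmx0, mul0mx, addr0) col_mx0.
have Bp : B *m p = 0.
  rewrite B_def mul_block_col laplacian_const//.
  by rewrite !(mulmx0, mul0mx, addr0) col_mx0.
have Ap : A^T *m p = const_mx 1.
  by rewrite A_def tr_col_mx mul_row_col mulmx0 addr0; exact: class_F_sum1.
rewrite (nb_imaginary_eigenvalues_modes q_gt0 Gpsd Bpsd A_rank Gp Bp Ap).
split; first exact: (synchronous_no_mode q_gt0 Bpsd Gp Bp Ap).
exact: (no_mode_synchronous q_gt0 w0_gt0 Gpsd Bpsd Gp Bp Ap).
Qed.
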